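(* Let $\alpha\in\mathbb{R}$ be either rational, or irrational with Liouville–Roth constant $\mu_0(\alpha)>2$. Then for every $\beta>0$ the set $F_2(\alpha,\beta)$ has Property A, i.e. every trigonometric polynomial $t\ge0$ on $\mathbb{T}^2$ with $\mathrm{freq}(t)\subseteq F_2(\alpha,\beta)-F_2(\alpha,\beta)$ is a uniform limit on $\mathbb{T}^2$ of functions $|p|^2$ with $p$ trigonometric polynomials satisfying $\mathrm{freq}(p)\subseteq F_2(\alpha,\beta)$.
   Context: $\mathbb{T}=\mathbb{R}/\mathbb{Z}$. $\mathfrak{T}_2$: trigonometric polynomials on $\mathbb{T}^2$; $\mathfrak{T}_2^+=\{t\in\mathfrak{T}_2:t\ge0\}$; for $F\subseteq\mathbb{Z}^2$, $\mathfrak{T}_2(F)=\{t:\mathrm{freq}(t)\subseteq F\}$, $\mathfrak{T}_2^+(F)=\mathfrak{T}_2^+\cap\mathfrak{T}_2(F)$, $\mathfrak{S}_2(F)=\{|p|^2:p\in\mathfrak{T}_2(F)\}$, $\mathfrak{U}_2(F)=\mathfrak{T}_2\cap\overline{\mathfrak{S}_2(F)}$ (sup-norm closure). $F$ has Property A if $\mathfrak{U}_2(F)=\mathfrak{T}_2^+(F-F)$. $F_2(\alpha,\beta)=\{(j,k)\in\mathbb{Z}^2:|k-j\alpha|<\beta\}$. For irrational $\alpha$, the Liouville–Roth constant (irrationality measure) $\mu_0(\alpha)$ is the supremum of all $\mu>0$ for which there are infinitely many pairs $(c,d)$ of coprime integers with $|\alpha+c/d|<|d|^{-\mu}$. *)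

(* Defs.v *)
From Stdlib Require Import Reals ZArith List.
Open Scope R_scope.

Record C := mkC { Re : R; Im : R }.
Definition C0 : C := mkC 0 0.
Definition Cadd (z w : C) : C := mkC (Re z + Re w) (Im z + Im w).
Definition Csub (z w : C) : C := mkC (Re z - Re w) (Im z - Im w).
Definition Cmul (z w : C) : C :=
  mkC (Re z * Re w - Im z * Im w) (Re z * Im w + Im z * Re w).
Definition Cabs (z : C) : R := sqrt (Re z ^ 2 + Im z ^ 2).
Definition Cabs2 (z : C) : R := Re z ^ 2 + Im z ^ 2.
Definition e2pi (theta : R) : C := mkC (cos (2 * PI * theta)) (sin (2 * PI * theta)).

(* A trigonometric polynomial on T^2 = (R/Z)^2 is given by a finite list of
   terms (frequency (j,k), coefficient c), standing for c e(j x + k y).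
   Functions on T^2 are modelled as (Z^2-periodic) functions R -> R -> C. *)
Definition term : Type := ((Z * Z) * C)%type.
Definition tp_eval (l : list term) (x y : R) : C :=
  fold_right (fun tm acc =>
      Cadd (Cmul (snd tm) (e2pi (IZR (fst (fst tm)) * x + IZR (snd (fst tm)) * y))) acc)
    C0 l.

Definition freq_in (F : Z * Z -> Prop) (l : list term) : Prop :=
  Forall (fun tm => F (fst tm)) l.

Definition TrigPoly (t : R -> R -> C) : Prop :=
  exists l : list term, forall x y, t x y = tp_eval l x y.

Definition TrigPolyF (F : Z * Z -> Prop) (t : R -> R -> C) : Prop :=
  exists l : list term, freq_in F l /\ forall x y, t x y = tp_eval l x y.

Definition nonneg (t : R -> R -> C) : Prop :=
  forall x y, Im (t x y) = 0 /\ 0 <= Re (t x y).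

Definition T2plus (F : Z * Z -> Prop) (t : R -> R -> C) : Prop :=
  TrigPolyF F t /\ nonneg t.

Definition in_closure_S2 (F : Z * Z -> Prop) (t : R -> R -> C) : Prop :=
  forall eps, 0 < eps ->
    exists p : R -> R -> C, TrigPolyF F p /\
      forall x y, Cabs (Csub (t x y) (mkC (Cabs2 (p x y)) 0)) < eps.

Definition U2 (F : Z * Z -> Prop) (t : R -> R -> C) : Prop :=
  TrigPoly t /\ in_closure_S2 F t.

Definition diffset (F : Z * Z -> Prop) (n : Z * Z) : Prop :=
  exists a b, F a /\ F b /\ n = ((fst a - fst b)%Z, (snd a - snd b)%Z).

Definition PropertyA (F : Z * Z -> Prop) : Prop :=
  forall t : R -> R -> C, U2 F t <-> T2plus (diffset F) t.

Definition F2 (alpha beta : R) (n : Z * Z) : Prop :=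
  Rabs (IZR (snd n) - IZR (fst n) * alpha) < beta.

Definition rational (alpha : R) : Prop :=
  exists p q : Z, q <> 0%Z /\ alpha = IZR p / IZR q.

(* mu_0(alpha) > 2, i.e. some mu > 2 belongs to the set whose supremum is mu_0:
   infinitely many coprime pairs (c,d) with |alpha + c/d| < |d|^(-mu).
   "Infinitely many" pairs in Z^2 = pairs of arbitrarily large size |c|+|d|. *)
Definition LR_gt2 (alpha : R) : Prop :=
  exists mu : R, 2 < mu /\
    forall M : Z, exists c d : Z,
      Z.gcd c d = 1%Z /\ d <> 0%Z /\ (M < Z.abs c + Z.abs d)%Z /\
      Rabs (alpha + IZR c / IZR d) < Rpower (IZR (Z.abs d)) (- mu).

(* Main.v *)
(** Write [level (j,k) = k - j alpha], so that [F2 alpha beta] is the set of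
    frequencies of level in [(-beta, beta)].  Given [t >= 0] and [eps > 0], scale
    [t + eps/2 = B (1 - u)] with [0 <= u <= rho < 1].  The Fourier coefficients of
    [u^n] are at most [rho^n] and polynomially many in [n], so the part
    [-sum A_n s^n / n] of [log (1 - s u)] carried by nonnegative levels, split so that
    [A_n + conj A_n = u^n], converges geometrically; [phi = exp (-sum A_n s^n / n)] and
    [psi = exp (sum (conj A_n) s^n / n)] are formal power series in [s] whose
    coefficients are trigonometric polynomials.  Formally
    [phi * conj phi = 1 - s u] and [phi = (1 - s u) psi].  The coefficients of [psi] have
    levels [<= 0], so the second identity confines the coefficients of [phi] to levels in
    [[0, Lmax]], where [Lmax = level a - level b], with [a, b] in [F2 alpha beta],
    bounds the levels of [t].  At [s = 1] the partial sums of [phi], multiplied by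
    [sqrt B] and shifted by [b], have frequencies in [F2 alpha beta] and squared moduli
    converging uniformly to [t + eps/2].  Conversely a Fourier coefficient, being an
    average over a fine grid, is bounded by the sup norm, which gives the
    easy inclusion. *)

From Stdlib Require Import Reals ZArith List.
From Stdlib Require Import Lra Lia Classical FunctionalExtensionality.
From Coquelicot Require Complex.
Require Import Defs.
Import ListNotations.
Open Scope R_scope.

(* Complex arithmetic and the modulus *)
Declare Scope C_scope.
Delimit Scope C_scope with C.
Bind Scope C_scope with C.

Definition RtoC (r : R) : C := mkC r 0.
Definition C1 : C := RtoC 1.
Definition Copp (z : C) : C := mkC (- Re z) (- Im z).
Definition Cconj (z : C) : C := mkC (Re z) (- Im z).

Infix "+" := Cadd : C_scope.
Infix "-" := Csub : C_scope.
Infix "*" := Cmul : C_scope.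
Notation "- z" := (Copp z) : C_scope.

Lemma C_ext (z w : C) : Re z = Re w -> Im z = Im w -> z = w.
Proof. destruct z, w; simpl; intros -> ->; reflexivity. Qed.

Ltac C_by_parts := intros; apply C_ext; simpl; ring.

Lemma C_ring : ring_theory C0 C1 Cadd Cmul Csub Copp (@eq C).
Proof. split; C_by_parts. Qed.

Add Ring C_ring : C_ring.

Lemma Cconj_add (z w : C) : Cconj (z + w) = (Cconj z + Cconj w)%C.
Proof. C_by_parts. Qed.

Lemma Cconj_mul (z w : C) : Cconj (z * w) = (Cconj z * Cconj w)%C.
Proof. C_by_parts. Qed.

Lemma Cmul_conj (z : C) : (z * Cconj z)%C = RtoC (Cabs2 z).
Proof. apply C_ext; unfold Cabs2; simpl; ring. Qed.

Lemma RtoC_mul (r s : R) : RtoC (r * s) = (RtoC r * RtoC s)%C.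
Proof. C_by_parts. Qed.

Lemma RtoC_add (r s : R) : RtoC (r + s) = (RtoC r + RtoC s)%C.
Proof. C_by_parts. Qed.

Lemma Cabs_Cmod (z : C) : Cabs z = Complex.Cmod (Re z, Im z).
Proof. reflexivity. Qed.

Lemma Cabs_ge_0 (z : C) : 0 <= Cabs z.
Proof. apply sqrt_pos. Qed.

Lemma Cabs_add (z w : C) : Cabs (z + w) <= Cabs z + Cabs w.
Proof. rewrite !Cabs_Cmod. exact (Complex.Cmod_triangle (Re z, Im z) (Re w, Im w)). Qed.

Lemma Cabs_mul (z w : C) : Cabs (z * w) = Cabs z * Cabs w.
Proof. rewrite !Cabs_Cmod. exact (Complex.Cmod_mult (Re z, Im z) (Re w, Im w)). Qed.

Lemma Cabs_RtoC (r : R) : Cabs (RtoC r) = Rabs r.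
Proof. unfold Cabs, RtoC; simpl. rewrite <- sqrt_Rsqr_abs. f_equal. unfold Rsqr; ring. Qed.

Lemma Cabs_opp (z : C) : Cabs (- z) = Cabs z.
Proof. unfold Cabs; simpl; f_equal; ring. Qed.

Lemma Cabs_conj (z : C) : Cabs (Cconj z) = Cabs z.
Proof. unfold Cabs; simpl; f_equal; ring. Qed.

Lemma Cabs_C0 : Cabs C0 = 0.
Proof. change C0 with (RtoC 0). rewrite Cabs_RtoC. apply Rabs_R0. Qed.

Lemma Cabs_C1 : Cabs C1 = 1.
Proof. unfold C1. rewrite Cabs_RtoC. apply Rabs_R1. Qed.

Lemma Rabs_Re_le (z : C) : Rabs (Re z) <= Cabs z.
Proof.
  rewrite <- sqrt_Rsqr_abs. apply sqrt_le_1_alt. unfold Rsqr. nra.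
Qed.

Lemma Rabs_Im_le (z : C) : Rabs (Im z) <= Cabs z.
Proof.
  rewrite <- sqrt_Rsqr_abs. apply sqrt_le_1_alt. unfold Rsqr. nra.
Qed.

Lemma Cabs_eq_0 (z : C) : Cabs z <= 0 -> z = C0.
Proof.
  intros H. pose proof (Rabs_Re_le z). pose proof (Rabs_Im_le z).
  apply C_ext; simpl; apply NNPP; intros H'; apply Rabs_pos_lt in H'; lra.
Qed.

(** Lets [canon] discard the frequencies whose coefficients cancel; it rests on the decidability of
    equality of reals. *)
Definition C_eq_dec (z w : C) : {z = w} + {z <> w}.
Proof.
  destruct (Req_dec_T (Re z) (Re w)) as [H1|H1].
  - destruct (Req_dec_T (Im z) (Im w)) as [H2|H2].
    + left; apply C_ext; assumption.
    + right; congruence.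
  - right; congruence.
Defined.

(** * The exponential on the unit circle *)

Lemma e2pi_add (a b : R) : e2pi (a + b) = (e2pi a * e2pi b)%C.
Proof.
  apply C_ext; simpl; rewrite Rmult_plus_distr_l;
    [rewrite cos_plus | rewrite sin_plus]; ring.
Qed.

Lemma e2pi_opp (a : R) : e2pi (- a) = Cconj (e2pi a).
Proof.
  apply C_ext; simpl; replace (2 * PI * - a) with (- (2 * PI * a)) by ring;
    [apply cos_neg | apply sin_neg].
Qed.

Lemma e2pi_0 : e2pi 0 = C1.
Proof. unfold e2pi, C1, RtoC. rewrite Rmult_0_r, cos_0, sin_0. reflexivity. Qed.

Lemma Cabs2_e2pi (a : R) : Cabs2 (e2pi a) = 1.
Proof.
  unfold Cabs2; simpl. pose proof (sin2_cos2 (2 * PI * a)) as H.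
  unfold Rsqr in H. lra.
Qed.

Lemma Cabs_e2pi (a : R) : Cabs (e2pi a) = 1.
Proof. change (Cabs (e2pi a)) with (sqrt (Cabs2 (e2pi a))). rewrite Cabs2_e2pi. apply sqrt_1. Qed.

Lemma e2pi_INR (n : nat) : e2pi (INR n) = C1.
Proof.
  apply C_ext; simpl.
  - replace (2 * PI * INR n) with (0 + 2 * INR n * PI) by ring. rewrite cos_period. apply cos_0.
  - replace (2 * PI * INR n) with (0 + 2 * INR n * PI) by ring. rewrite sin_period. apply sin_0.
Qed.

Lemma e2pi_IZR (m : Z) : e2pi (IZR m) = C1.
Proof.
  destruct (Z_le_gt_dec 0 m) as [H|H].
  - rewrite <- (Z2Nat.id m H), <- INR_IZR_INZ. apply e2pi_INR.
  - replace (IZR m) with (- IZR (- m)) by (rewrite opp_IZR; ring).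
    rewrite <- (Z2Nat.id (- m)) by lia. rewrite <- INR_IZR_INZ, e2pi_opp, e2pi_INR.
    apply C_ext; simpl; ring.
Qed.

(** The real part is [1 - 2 sin^2 (PI a)], and the sine of [PI |a|] is positive strictly between 0
    and [PI]. *)
Lemma e2pi_neq_1 (a : R) : 0 < Rabs a < 1 -> e2pi a <> C1.
Proof.
  intros Ha H. apply (f_equal Re) in H. simpl in H.
  replace (2 * PI * a) with (2 * (PI * a)) in H by ring.
  rewrite cos_2a_sin in H.
  assert (Hs : sin (PI * Rabs a) = 0).
  { unfold Rabs. destruct (Rcase_abs a).
    - replace (PI * - a) with (- (PI * a)) by ring. rewrite sin_neg. nra.
    - nra. }
  pose proof PI_RGT_0.
  assert (0 < sin (PI * Rabs a)) by (apply sin_gt_0; nra).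
  lra.
Qed.

(** * Finite sums and orthogonality of roots of unity *)

Fixpoint csum (n : nat) (f : nat -> C) : C :=
  match n with O => C0 | S m => (csum m f + f m)%C end.

Lemma csum_ext (n : nat) (f g : nat -> C) :
  (forall i, f i = g i) -> csum n f = csum n g.
Proof. intros H; induction n; simpl; rewrite ?IHn, ?H; reflexivity. Qed.

Lemma csum_add (n : nat) (f g : nat -> C) :
  csum n (fun i => f i + g i)%C = (csum n f + csum n g)%C.
Proof. induction n; simpl; rewrite ?IHn; ring. Qed.

Lemma csum_mul_l (n : nat) (c : C) (f : nat -> C) :
  csum n (fun i => c * f i)%C = (c * csum n f)%C.
Proof. induction n; simpl; rewrite ?IHn; ring. Qed.

Lemma csum_mul_r (n : nat) (c : C) (f : nat -> C) :
  csum n (fun i => f i * c)%C = (csum n f * c)%C.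
Proof. induction n; simpl; rewrite ?IHn; ring. Qed.

Lemma csum_bound (n : nat) (f : nat -> C) (M : R) :
  (forall i, Cabs (f i) <= M) -> Cabs (csum n f) <= INR n * M.
Proof.
  intros H; induction n as [|n IH].
  - simpl. rewrite Cabs_C0. lra.
  - rewrite S_INR. simpl. pose proof (Cabs_add (csum n f) (f n)). specialize (H n). lra.
Qed.

Lemma csum_C1 (n : nat) : csum n (fun _ => C1) = RtoC (INR n).
Proof.
  induction n as [|n IH]; [reflexivity|]. rewrite S_INR. simpl. rewrite IH. C_by_parts.
Qed.

Lemma csum_C0 (n : nat) : csum n (fun _ => C0) = C0.
Proof. induction n as [|n IH]; [reflexivity|]. simpl. rewrite IH. ring. Qed.

Lemma Cmul_integral (z w : C) : (z * w)%C = C0 -> z <> C0 -> w = C0.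
Proof.
  intros H Hz. apply Cabs_eq_0. apply (f_equal Cabs) in H.
  rewrite Cabs_mul, Cabs_C0 in H.
  destruct (Rmult_integral _ _ H) as [H0|H0]; [|lra].
  exfalso. apply Hz, Cabs_eq_0. lra.
Qed.

(** A geometric sum with ratio [z = e(m/N)]: times [z - 1] it telescopes to [e(m) - 1 = 0], and [z]
    differs from 1 when [0 < |m| < N]. *)
Lemma csum_roots_of_unity (N : nat) (m : Z) :
  (Z.abs m < Z.of_nat N)%Z ->
  csum N (fun a => e2pi (IZR m * (INR a / INR N)))
  = if Z.eq_dec m 0 then RtoC (INR N) else C0.
Proof.
  intros HN.
  assert (HN0 : 0 < INR N) by (apply lt_0_INR; lia).
  destruct (Z.eq_dec m 0) as [->|Hm].
  - rewrite <- csum_C1. apply csum_ext. intros i. rewrite Rmult_0_l. apply e2pi_0.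
  - set (z := e2pi (IZR m / INR N)).
    assert (Hz : z <> C1).
    { apply e2pi_neq_1. unfold Rdiv.
      rewrite Rabs_mult, Rabs_inv, (Rabs_pos_eq (INR N)) by lra.
      rewrite <- abs_IZR. assert (0 < / INR N) by (apply Rinv_0_lt_compat; lra).
      assert (0 < IZR (Z.abs m)) by (apply IZR_lt; lia).
      apply IZR_lt in HN. rewrite <- INR_IZR_INZ in HN.
      split; [nra|]. apply Rmult_lt_reg_r with (INR N); [lra|].
      rewrite Rmult_assoc, Rinv_l; lra. }
    assert (Hgeo : forall n, ((z - C1) * csum n (fun a => e2pi (IZR m * (INR a / INR N)))
        = e2pi (IZR m * (INR n / INR N)) - C1)%C).
    { induction n as [|n IH].
      - simpl. replace (IZR m * (0 / INR N)) with 0 by (field; lra). rewrite e2pi_0. ring.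
      - rewrite S_INR. simpl csum.
        replace (IZR m * ((INR n + 1) / INR N)) with
          (IZR m * (INR n / INR N) + IZR m / INR N) by (field; lra).
        rewrite e2pi_add. fold z.
        transitivity ((z - C1) * csum n (fun a => e2pi (IZR m * (INR a / INR N)))
           + (z - C1) * e2pi (IZR m * (INR n / INR N)))%C; [ring|].
        rewrite IH. ring. }
    specialize (Hgeo N).
    replace (IZR m * (INR N / INR N)) with (IZR m) in Hgeo by (field; lra).
    rewrite e2pi_IZR in Hgeo.
    apply (Cmul_integral (z - C1)%C); [rewrite Hgeo; ring|].
    intros H. apply Hz. transitivity (z - C1 + C1)%C; [ring|]. rewrite H. ring.
Qed.

(** * Fourier coefficients of trigonometric polynomials *)

Definition Zpair_eq_dec (m n : Z * Z) : {m = n} + {m <> n}.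
Proof. decide equality; apply Z.eq_dec. Qed.

Definition character (n : Z * Z) (x y : R) : C :=
  e2pi (IZR (fst n) * x + IZR (snd n) * y).

Definition Zpair_add (m n : Z * Z) : Z * Z := ((fst m + fst n)%Z, (snd m + snd n)%Z).
Definition Zpair_opp (n : Z * Z) : Z * Z := ((- fst n)%Z, (- snd n)%Z).

Lemma character_add (m n : Z * Z) (x y : R) :
  character (Zpair_add m n) x y = (character m x y * character n x y)%C.
Proof.
  unfold character. rewrite <- e2pi_add. f_equal. simpl. rewrite !plus_IZR. ring.
Qed.

Lemma character_opp (n : Z * Z) (x y : R) :
  character (Zpair_opp n) x y = Cconj (character n x y).
Proof.
  unfold character. rewrite <- e2pi_opp. f_equal. simpl. rewrite !opp_IZR. ring.
Qed.

Lemma tp_eval_cons (n : Z * Z) (c : C) (l : list term) (x y : R) :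
  tp_eval ((n, c) :: l) x y = (c * character n x y + tp_eval l x y)%C.
Proof. reflexivity. Qed.

Lemma tp_eval_app (l1 l2 : list term) (x y : R) :
  tp_eval (l1 ++ l2) x y = (tp_eval l1 x y + tp_eval l2 x y)%C.
Proof.
  induction l1 as [|[n c] l1 IH]; [simpl; ring|].
  rewrite <- app_comm_cons, !tp_eval_cons, IH. ring.
Qed.

Definition term_mul (s t : term) : term :=
  (Zpair_add (fst s) (fst t), (snd s * snd t)%C).

Fixpoint tp_mul (l1 l2 : list term) : list term :=
  match l1 with
  | [] => []
  | s :: l1' => map (term_mul s) l2 ++ tp_mul l1' l2
  end.

Lemma tp_eval_mul (l1 l2 : list term) (x y : R) :
  tp_eval (tp_mul l1 l2) x y = (tp_eval l1 x y * tp_eval l2 x y)%C.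
Proof.
  assert (Hmap : forall s, tp_eval (map (term_mul s) l2) x y
      = (snd s * character (fst s) x y * tp_eval l2 x y)%C).
  { intros [m b]. induction l2 as [|[n c] l2 IH]; [simpl; ring|].
    simpl map. unfold term_mul at 1. simpl fst. simpl snd.
    rewrite !tp_eval_cons, IH, character_add. simpl. ring. }
  induction l1 as [|[n c] l1 IH]; [simpl; ring|].
  simpl tp_mul. rewrite tp_eval_app, Hmap, IH, tp_eval_cons. simpl. ring.
Qed.

Lemma freq_in_mul (S1 S2 S : Z * Z -> Prop) (l1 l2 : list term) :
  (forall m n, S1 m -> S2 n -> S (Zpair_add m n)) ->
  freq_in S1 l1 -> freq_in S2 l2 -> freq_in S (tp_mul l1 l2).
Proof.
  intros HS H1 H2. unfold freq_in in *. induction H1 as [|s l1 Hs H1 IH]; [constructor|].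
  simpl. apply Forall_app. split; [|exact IH].
  apply Forall_map. eapply Forall_impl; [|exact H2]. simpl. intros t Ht. apply HS; assumption.
Qed.

Definition tp_conj (l : list term) : list term :=
  map (fun t => (Zpair_opp (fst t), Cconj (snd t))) l.

Lemma tp_eval_conj (l : list term) (x y : R) :
  tp_eval (tp_conj l) x y = Cconj (tp_eval l x y).
Proof.
  induction l as [|[n c] l IH]; [C_by_parts|].
  simpl tp_conj. rewrite !tp_eval_cons. fold (tp_conj l).
  rewrite IH, character_opp, Cconj_add, Cconj_mul. reflexivity.
Qed.

Definition tp_norm (l : list term) : R := fold_right (fun t acc => Cabs (snd t) + acc) 0 l.

Lemma tp_eval_bound (l : list term) (x y : R) : Cabs (tp_eval l x y) <= tp_norm l.
Proof.
  induction l as [|[n c] l IH]; simpl tp_norm.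
  - simpl. rewrite Cabs_C0. lra.
  - rewrite tp_eval_cons. eapply Rle_trans; [apply Cabs_add|].
    unfold character. rewrite Cabs_mul, Cabs_e2pi. lra.
Qed.

(** * Fourier coefficients as averages over a grid *)

Definition coef (l : list term) (n : Z * Z) : C :=
  fold_right (fun t acc => if Zpair_eq_dec (fst t) n then (snd t + acc)%C else acc) C0 l.

Lemma coef_app (l1 l2 : list term) (n : Z * Z) :
  coef (l1 ++ l2) n = (coef l1 n + coef l2 n)%C.
Proof.
  induction l1 as [|[m c] l1 IH]; simpl; [ring|].
  destruct (Zpair_eq_dec m n); rewrite IH; ring.
Qed.

Lemma coef_support (S : Z * Z -> Prop) (l : list term) (n : Z * Z) :
  freq_in S l -> coef l n <> C0 -> S n.
Proof.
  intros H. induction H as [|[m c] l Hm H IH]; simpl; [tauto|].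
  destruct (Zpair_eq_dec m n) as [<-|]; auto.
Qed.

(** Discrete substitute for the integral over the torus: after division by [N^2] it is exact on
    characters whose frequency coordinates are below [N] in absolute value. *)
Definition grid_sum (N : nat) (f : R -> R -> C) : C :=
  csum N (fun a => csum N (fun b => f (INR a / INR N) (INR b / INR N))).

Lemma grid_sum_ext (N : nat) (f g : R -> R -> C) :
  (forall x y, f x y = g x y) -> grid_sum N f = grid_sum N g.
Proof. intros H. apply csum_ext; intros a. apply csum_ext; intros b. apply H. Qed.

Lemma grid_sum_add (N : nat) (f g : R -> R -> C) :
  grid_sum N (fun x y => f x y + g x y)%C = (grid_sum N f + grid_sum N g)%C.
Proof.
  unfold grid_sum. rewrite <- csum_add. apply csum_ext; intros a. apply csum_add.
Qed.

Lemma grid_sum_character (N : nat) (c : C) (m : Z * Z) :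
  (Z.abs (fst m) < Z.of_nat N)%Z -> (Z.abs (snd m) < Z.of_nat N)%Z ->
  grid_sum N (fun x y => c * character m x y)%C
  = if Zpair_eq_dec m (0, 0)%Z then (RtoC (INR N) * RtoC (INR N) * c)%C else C0.
Proof.
  intros H1 H2. unfold grid_sum.
  transitivity (csum N (fun a => (c * csum N (fun b => e2pi (IZR (snd m) * (INR b / INR N))))
      * e2pi (IZR (fst m) * (INR a / INR N)))%C).
  { apply csum_ext; intros a. rewrite <- (csum_mul_l N c), <- csum_mul_r.
    unfold character. apply csum_ext; intros b. rewrite e2pi_add. ring. }
  rewrite csum_mul_l, !csum_roots_of_unity by assumption.
  destruct m as [j k]; simpl fst; simpl snd.
  destruct (Z.eq_dec j 0); destruct (Z.eq_dec k 0); destruct (Zpair_eq_dec (j, k) (0, 0)%Z);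
    subst; try congruence; ring.
Qed.

Lemma grid_sum_coef (l : list term) (n : Z * Z) :
  exists N0 : nat, forall N, (N0 <= N)%nat ->
    grid_sum N (fun x y => tp_eval l x y * character (Zpair_opp n) x y)%C
    = (RtoC (INR N) * RtoC (INR N) * coef l n)%C.
Proof.
  induction l as [|[m c] l [N0 IH]].
  - exists O. intros N _. simpl.
    rewrite (grid_sum_ext N _ (fun _ _ => C0)) by (intros; ring).
    unfold grid_sum. rewrite (csum_ext N _ (fun _ => C0)) by (intros; apply csum_C0).
    rewrite csum_C0. ring.
  - set (d := Zpair_add m (Zpair_opp n)).
    (* Such an [N] exceeds both coordinates of [d], so no nonzero difference of frequencies is
       aliased to 0 modulo [N]. *)
    exists (Nat.max N0 (Z.to_nat (Z.abs (fst d) + Z.abs (snd d) + 1))). intros N HN.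
    rewrite (grid_sum_ext N _ (fun x y => c * character d x y
        + tp_eval l x y * character (Zpair_opp n) x y)%C).
    2:{ intros x y. rewrite tp_eval_cons. unfold d. rewrite character_add. ring. }
    rewrite grid_sum_add, IH, grid_sum_character by lia.
    simpl coef. destruct m as [j k], n as [j' k'].
    destruct (Zpair_eq_dec d (0, 0)%Z) as [e|e]; destruct (Zpair_eq_dec (j, k) (j', k')) as [e'|e'];
      try ring; exfalso; unfold d, Zpair_add, Zpair_opp in e; simpl in e.
    + injection e; intros. apply e'. f_equal; lia.
    + injection e'; intros. apply e. f_equal; lia.
Qed.

(** The coefficient is the grid average of the polynomial times a character of modulus 1. *)
Lemma coef_bound (l : list term) (n : Z * Z) (M : R) :
  (forall x y, Cabs (tp_eval l x y) <= M) -> Cabs (coef l n) <= M.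
Proof.
  intros HM. destruct (grid_sum_coef l n) as [N0 HN].
  (* The successor keeps the grid nonempty, so that [N^2] can be cancelled. *)
  set (N := S N0). specialize (HN N ltac:(unfold N; lia)).
  assert (HN0 : 0 < INR N) by (apply lt_0_INR; unfold N; lia).
  assert (H : Cabs (grid_sum N (fun x y => tp_eval l x y * character (Zpair_opp n) x y)%C)
      <= INR N * (INR N * M)).
  { apply csum_bound. intros a. apply csum_bound. intros b.
    unfold character. rewrite Cabs_mul, Cabs_e2pi, Rmult_1_r. apply HM. }
  rewrite HN, !Cabs_mul, Cabs_RtoC, Rabs_pos_eq in H by lra.
  assert (0 < INR N * INR N) by nra.
  apply Rmult_le_reg_l with (INR N * INR N); lra.
Qed.

Lemma tp_norm_const_bound (l : list term) (M : R) :
  (forall t, In t l -> Cabs (snd t) <= M) -> tp_norm l <= INR (length l) * M.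
Proof.
  induction l as [|t l IH]; intros H; [simpl; lra|].
  change (tp_norm (t :: l)) with (Cabs (snd t) + tp_norm l).
  simpl length. rewrite S_INR.
  pose proof (H t (or_introl eq_refl)). specialize (IH (fun t Ht => H t (or_intror Ht))). lra.
Qed.

(** * Normal form with collected frequencies *)

Definition tp_of_coefs (f : Z * Z -> C) (K : list (Z * Z)) : list term :=
  map (fun n => (n, f n)) K.

Definition coef_nonzero (l : list term) (n : Z * Z) : bool :=
  if C_eq_dec (coef l n) C0 then false else true.

(** Each frequency occurs once and with nonzero coefficient. Collecting terms matters for size: the
    product lists of [tp_mul] multiply [tp_norm], whatever cancellation occurs in the function. *)
Definition canon (l : list term) : list term :=
  tp_of_coefs (coef l) (filter (coef_nonzero l) (nodup Zpair_eq_dec (map fst l))).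

Lemma canon_support (l : list term) : freq_in (fun n => coef l n <> C0) (canon l).
Proof.
  unfold freq_in, canon, tp_of_coefs. apply Forall_map, Forall_forall. simpl.
  intros n Hn. apply filter_In in Hn. destruct Hn as [_ Hn]. unfold coef_nonzero in Hn.
  destruct (C_eq_dec (coef l n) C0); congruence.
Qed.

Lemma tp_of_coefs_cons (f : Z * Z -> C) (n : Z * Z) (K : list (Z * Z)) (x y : R) :
  tp_eval (tp_of_coefs f (n :: K)) x y
  = (f n * character n x y + tp_eval (tp_of_coefs f K) x y)%C.
Proof. reflexivity. Qed.

Lemma tp_of_coefs_add (f g : Z * Z -> C) (K : list (Z * Z)) (x y : R) :
  tp_eval (tp_of_coefs (fun n => f n + g n)%C K) x y
  = (tp_eval (tp_of_coefs f K) x y + tp_eval (tp_of_coefs g K) x y)%C.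
Proof.
  induction K as [|n K IH]; [simpl; ring|].
  rewrite !tp_of_coefs_cons, IH. ring.
Qed.

Lemma tp_of_coefs_ext (f g : Z * Z -> C) (K : list (Z * Z)) :
  (forall n, f n = g n) -> tp_of_coefs f K = tp_of_coefs g K.
Proof. intros H. apply map_ext. intros n. rewrite H. reflexivity. Qed.

Lemma tp_of_coefs_single (m : Z * Z) (c : C) (K : list (Z * Z)) (x y : R) :
  NoDup K ->
  tp_eval (tp_of_coefs (fun n => if Zpair_eq_dec m n then c else C0) K) x y
  = if in_dec Zpair_eq_dec m K then (c * character m x y)%C else C0.
Proof.
  induction 1 as [|n K Hn HK IH]; [reflexivity|].
  rewrite tp_of_coefs_cons, IH.
  destruct (Zpair_eq_dec m n) as [<-|e].
  - destruct (in_dec Zpair_eq_dec m K); [contradiction|].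
    destruct (in_dec Zpair_eq_dec m (m :: K)) as [|e]; [ring|].
    exfalso; apply e; left; reflexivity.
  - destruct (in_dec Zpair_eq_dec m K) as [i|i];
    destruct (in_dec Zpair_eq_dec m (n :: K)) as [i'|i']; try ring; exfalso.
    + apply i'; right; assumption.
    + destruct i' as [|]; [apply e; congruence | contradiction].
Qed.

(** Induction on [l]: a new term adds to [coef] a function supported at one frequency, and [K] lists
    that frequency exactly once. *)
Lemma tp_eval_of_coefs (l : list term) (K : list (Z * Z)) (x y : R) :
  NoDup K -> incl (map fst l) K ->
  tp_eval (tp_of_coefs (coef l) K) x y = tp_eval l x y.
Proof.
  intros HK. induction l as [|[m c] l IH]; intros Hincl.
  - clear. induction K as [|n K IH]; [reflexivity|].
    rewrite tp_of_coefs_cons, IH. simpl. ring.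
  - rewrite (tp_of_coefs_ext _ (fun n => (if Zpair_eq_dec m n then c else C0) + coef l n)%C).
    2:{ intros n. simpl. destruct (Zpair_eq_dec m n); ring. }
    rewrite tp_of_coefs_add, tp_of_coefs_single, IH by
      (try assumption; intros n Hn; apply Hincl; right; exact Hn).
    rewrite tp_eval_cons.
    destruct (in_dec Zpair_eq_dec m K) as [|e]; [reflexivity|].
    exfalso. apply e, Hincl. left; reflexivity.
Qed.

Lemma tp_eval_canon (l : list term) (x y : R) : tp_eval (canon l) x y = tp_eval l x y.
Proof.
  rewrite <- (tp_eval_of_coefs l (nodup Zpair_eq_dec (map fst l))).
  - unfold canon. induction (nodup Zpair_eq_dec (map fst l)) as [|n K IH]; [reflexivity|].
    simpl filter. unfold coef_nonzero at 1.
    destruct (C_eq_dec (coef l n) C0) as [e|e].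
    + rewrite tp_of_coefs_cons, e, IH. ring.
    + rewrite !tp_of_coefs_cons, IH. reflexivity.
  - apply NoDup_nodup.
  - intros n Hn. apply nodup_In. exact Hn.
Qed.

Definition box (D : nat) (n : Z * Z) : Prop :=
  (Z.abs (fst n) <= Z.of_nat D)%Z /\ (Z.abs (snd n) <= Z.of_nat D)%Z.

(** The box has [(2D+1)^2] lattice points, and each collected coefficient is at most the sup norm by
    [coef_bound]. *)
Lemma canon_norm_bound (l : list term) (D : nat) (M : R) :
  freq_in (box D) l -> (forall x y, Cabs (tp_eval l x y) <= M) ->
  tp_norm (canon l) <= INR (2 * D + 1) ^ 2 * M.
Proof.
  intros HD HM.
  assert (HM0 : 0 <= M) by (eapply Rle_trans; [apply Cabs_ge_0 | apply (HM 0 0)]).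
  eapply Rle_trans; [apply tp_norm_const_bound with (M := M)|].
  { intros t Ht. unfold canon, tp_of_coefs in Ht. apply in_map_iff in Ht.
    destruct Ht as [n [<- _]]. apply coef_bound, HM. }
  apply Rmult_le_compat_r; [exact HM0|].
  unfold canon, tp_of_coefs. rewrite length_map.
  (* [I] enumerates the integers from [-D] to [D]. *)
  set (I := map (fun i => (Z.of_nat i - Z.of_nat D)%Z) (seq 0 (2 * D + 1))).
  replace (INR (2 * D + 1) ^ 2) with (INR (length (list_prod I I))).
  2:{ rewrite length_prod. unfold I. rewrite length_map, length_seq, mult_INR. ring. }
  apply le_INR, NoDup_incl_length; [apply NoDup_filter, NoDup_nodup|].
  assert (HI : forall z, (Z.abs z <= Z.of_nat D)%Z -> In z I).
  { intros z Hz. apply in_map_iff. exists (Z.to_nat (z + Z.of_nat D)).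
    split; [lia | apply in_seq; lia]. }
  intros [j k] Hn. apply filter_In in Hn. destruct Hn as [Hn _].
  rewrite nodup_In, in_map_iff in Hn. destruct Hn as [t [Ht Hin]].
  unfold freq_in in HD. rewrite Forall_forall in HD. destruct (HD t Hin) as [H1 H2].
  rewrite Ht in *. apply in_prod; apply HI; assumption.
Qed.

(** * Functions with prescribed frequencies *)

Lemma freq_in_impl (S1 S2 : Z * Z -> Prop) (l : list term) :
  (forall n, S1 n -> S2 n) -> freq_in S1 l -> freq_in S2 l.
Proof. intros H. apply Forall_impl. intros t. apply H. Qed.

Lemma TrigPolyF_impl (S1 S2 : Z * Z -> Prop) (f : R -> R -> C) :
  (forall n, S1 n -> S2 n) -> TrigPolyF S1 f -> TrigPolyF S2 f.
Proof.
  intros H [l [Hl Hf]]. exists l. split; [|exact Hf]. eapply freq_in_impl; eassumption.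
Qed.

Lemma TrigPolyF_ext (S : Z * Z -> Prop) (f g : R -> R -> C) :
  (forall x y, f x y = g x y) -> TrigPolyF S f -> TrigPolyF S g.
Proof.
  intros H [l [Hl Hf]]. exists l. split; [exact Hl|]. intros. rewrite <- H. apply Hf.
Qed.

Lemma TrigPolyF_add (S : Z * Z -> Prop) (f g : R -> R -> C) :
  TrigPolyF S f -> TrigPolyF S g -> TrigPolyF S (fun x y => f x y + g x y)%C.
Proof.
  intros [l [Hl Hf]] [l' [Hl' Hg]]. exists (l ++ l'). split.
  - apply Forall_app; split; assumption.
  - intros. rewrite tp_eval_app, Hf, Hg. reflexivity.
Qed.

Lemma TrigPolyF_mul (S1 S2 S : Z * Z -> Prop) (f g : R -> R -> C) :
  (forall m n, S1 m -> S2 n -> S (Zpair_add m n)) ->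
  TrigPolyF S1 f -> TrigPolyF S2 g -> TrigPolyF S (fun x y => f x y * g x y)%C.
Proof.
  intros HS [l [Hl Hf]] [l' [Hl' Hg]]. exists (tp_mul l l'). split.
  - eapply freq_in_mul; eassumption.
  - intros. rewrite tp_eval_mul, Hf, Hg. reflexivity.
Qed.

Lemma TrigPolyF_conj (S1 S2 : Z * Z -> Prop) (f : R -> R -> C) :
  (forall n, S1 n -> S2 (Zpair_opp n)) ->
  TrigPolyF S1 f -> TrigPolyF S2 (fun x y => Cconj (f x y)).
Proof.
  intros HS [l [Hl Hf]]. exists (tp_conj l). split.
  - unfold freq_in, tp_conj. apply Forall_map. eapply Forall_impl; [|exact Hl].
    intros t. apply HS.
  - intros. rewrite tp_eval_conj, Hf. reflexivity.
Qed.

Lemma TrigPolyF_monomial (S : Z * Z -> Prop) (n : Z * Z) (c : C) :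
  S n -> TrigPolyF S (fun x y => c * character n x y)%C.
Proof.
  intros Hn. exists [(n, c)]. split; [constructor; [exact Hn|constructor]|].
  intros. simpl. unfold character. ring.
Qed.

Lemma character_0 (x y : R) : character (0, 0)%Z x y = C1.
Proof. unfold character. simpl. rewrite !Rmult_0_l, Rplus_0_l. apply e2pi_0. Qed.

Lemma TrigPolyF_const (S : Z * Z -> Prop) (c : C) :
  S (0, 0)%Z -> TrigPolyF S (fun _ _ => c).
Proof.
  intros H. apply TrigPolyF_ext with (fun x y => c * character (0, 0)%Z x y)%C.
  - intros. rewrite character_0. ring.
  - apply TrigPolyF_monomial, H.
Qed.

Lemma TrigPolyF_coef_support (S : Z * Z -> Prop) (l : list term) :
  (forall n, coef l n <> C0 -> S n) -> TrigPolyF S (tp_eval l).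
Proof.
  intros H. exists (canon l). split.
  - eapply freq_in_impl; [exact H | apply canon_support].
  - intros. symmetry. apply tp_eval_canon.
Qed.

(** * Uniqueness of Fourier coefficients and the easy inclusion *)

Definition tp_opp (l : list term) : list term := tp_mul [((0, 0)%Z, (- C1)%C)] l.

Lemma tp_eval_opp (l : list term) (x y : R) : tp_eval (tp_opp l) x y = (- tp_eval l x y)%C.
Proof.
  unfold tp_opp. rewrite tp_eval_mul, tp_eval_cons, character_0.
  change (tp_eval [] x y) with C0. ring.
Qed.

Lemma coef_opp (l : list term) (n : Z * Z) : coef (tp_opp l) n = (- coef l n)%C.
Proof.
  unfold tp_opp. simpl. rewrite app_nil_r.
  induction l as [|[[j k] c] l IH]; [C_by_parts|]. simpl. rewrite IH.
  unfold Zpair_add; simpl. destruct (Zpair_eq_dec (j, k) n); C_by_parts.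
Qed.

(** The difference of the two polynomials has sup norm 0, hence zero coefficients by
    [coef_bound]. *)
Lemma coef_eq (l1 l2 : list term) (n : Z * Z) :
  (forall x y, tp_eval l1 x y = tp_eval l2 x y) -> coef l1 n = coef l2 n.
Proof.
  intros H.
  assert (H0 : coef (l1 ++ tp_opp l2) n = C0).
  { apply Cabs_eq_0, coef_bound. intros x y.
    rewrite tp_eval_app, tp_eval_opp, H.
    replace (tp_eval l2 x y + - tp_eval l2 x y)%C with C0 by ring. rewrite Cabs_C0. lra. }
  rewrite coef_app, coef_opp in H0.
  transitivity (coef l1 n + - coef l2 n + coef l2 n)%C; [ring|]. rewrite H0. ring.
Qed.

(** By uniqueness of coefficients, the support of a function lies in every frequency set that can
    represent it. This combines the lower and the upper level bound of the spectral factor, which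
    come from different formulas. *)
Lemma TrigPolyF_inter (S1 S2 : Z * Z -> Prop) (f : R -> R -> C) :
  TrigPolyF S1 f -> TrigPolyF S2 f -> TrigPolyF (fun n => S1 n /\ S2 n) f.
Proof.
  intros [l1 [H1 E1]] [l2 [H2 E2]].
  apply TrigPolyF_ext with (tp_eval l1); [intros; symmetry; apply E1|].
  apply TrigPolyF_coef_support. intros n Hn. split.
  - apply (coef_support _ l1); assumption.
  - apply (coef_support _ l2); [assumption|].
    rewrite (coef_eq l2 l1); [exact Hn|]. intros. rewrite <- E1, <- E2. reflexivity.
Qed.

(** The frequencies of [|p|^2] lie in [F - F], so a coefficient of [t] elsewhere is also a
    coefficient of [t - |p|^2], which is uniformly small. *)
Lemma U2_T2plus (F : Z * Z -> Prop) (t : R -> R -> C) : U2 F t -> T2plus (diffset F) t.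
Proof.
  intros [[l Hl] Hcl]. split.
  - apply TrigPolyF_ext with (tp_eval l); [intros; symmetry; apply Hl|].
    apply TrigPolyF_coef_support. intros n Hn. apply NNPP. intros HF.
    apply Hn, Cabs_eq_0, Rnot_lt_le. intros Hpos.
    (* With half the coefficient as tolerance, [coef_bound] would give [|c| <= |c|/2]. *)
    destruct (Hcl (Cabs (coef l n) / 2) ltac:(lra)) as [p [Hp Hlt]].
    destruct (TrigPolyF_mul F (fun n => F (Zpair_opp n)) (diffset F) p (fun x y => Cconj (p x y)))
      as [q [Hq Eq]].
    + intros a b Ha Hb. exists a, (Zpair_opp b). repeat split; try assumption.
      unfold Zpair_add, Zpair_opp; simpl. f_equal; lia.
    + exact Hp.
    + eapply TrigPolyF_conj; [|exact Hp]. intros [j k]. unfold Zpair_opp; simpl.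
      rewrite !Z.opp_involutive. trivial.
    + assert (Hqn : coef q n = C0).
      { apply NNPP. intros H. exact (HF (coef_support _ _ _ Hq H)). }
      assert (Hb : Cabs (coef (l ++ tp_opp q) n) <= Cabs (coef l n) / 2).
      { apply coef_bound. intros x y. rewrite tp_eval_app, tp_eval_opp, <- Eq, <- Hl, Cmul_conj.
        left. exact (Hlt x y). }
      rewrite coef_app, coef_opp, Hqn in Hb.
      replace (coef l n + - C0)%C with (coef l n) in Hb by ring. lra.
  - intros x y. split.
    (* Since [|p|^2] is real and nonnegative, its distance from [t] is at least [|Im t|], and at
       least [- Re t] where [Re t < 0]. These two values serve as tolerances. *)
    + apply NNPP. intros H. apply Rabs_pos_lt in H. destruct (Hcl _ H) as [p [_ Hp]].
      specialize (Hp x y).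
      pose proof (Rabs_Im_le (t x y - mkC (Cabs2 (p x y)) 0)%C) as H'. simpl in H'.
      rewrite Rminus_0_r in H'. lra.
    + apply Rnot_lt_le. intros H. destruct (Hcl (- Re (t x y)) ltac:(lra)) as [p [_ Hp]].
      specialize (Hp x y).
      pose proof (Rabs_Re_le (t x y - mkC (Cabs2 (p x y)) 0)%C) as H'. simpl in H'.
      assert (0 <= Cabs2 (p x y)) by (unfold Cabs2; nra).
      pose proof (Rle_abs (- (Re (t x y) - Cabs2 (p x y)))) as H''.
      rewrite Rabs_Ropp in H''. lra.
Qed.

(** * Formal power series *)

Definition fps : Type := nat -> C.

Definition shift (a : fps) : fps := fun n => a (S n).
Definition fconst (c : C) : fps := fun n => match n with O => c | S _ => C0 end.
Definition fadd (a b : fps) : fps := fun n => (a n + b n)%C.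
Definition fsub (a b : fps) : fps := fun n => (a n - b n)%C.
Definition fopp (a : fps) : fps := fun n => (- a n)%C.
Definition fconj (a : fps) : fps := fun n => Cconj (a n).

(** Cauchy product, computed by peeling off the first coefficient of [a], so that proofs go by
    induction on the index with [a] replaced by [shift a]. *)
Fixpoint conv (a b : fps) (n : nat) : C :=
  match n with
  | O => (a O * b O)%C
  | S m => (a O * b (S m) + conv (shift a) b m)%C
  end.

(** The derivation [s d/ds]; it multiplies the coefficient of [s^n] by [n]. *)
Definition euler (a : fps) : fps := fun n => (RtoC (INR n) * a n)%C.

Lemma conv_ext (n : nat) : forall a a' b b' : fps,
  (forall i, (i <= n)%nat -> a i = a' i) -> (forall i, (i <= n)%nat -> b i = b' i) ->
  conv a b n = conv a' b' n.
Proof.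
  induction n as [|n IH]; intros a a' b b' Ha Hb; simpl.
  - rewrite Ha, Hb by lia. reflexivity.
  - rewrite Ha, Hb by lia. f_equal. apply IH; intros i Hi; [apply Ha | apply Hb]; lia.
Qed.

(** Peels the last coefficient of [a] against the first of [b]; together with the defining recursion
    this gives commutativity. *)
Lemma conv_S_r (n : nat) : forall a b : fps,
  conv a b (S n) = (conv a (shift b) n + a (S n) * b O)%C.
Proof.
  induction n as [|n IH]; intros a b; [simpl; unfold shift; ring|].
  change (conv a b (S (S n))) with (a O * b (S (S n)) + conv (shift a) b (S n))%C.
  rewrite IH. simpl. unfold shift. ring.
Qed.

Lemma conv_comm (n : nat) : forall a b : fps, conv a b n = conv b a n.
Proof.
  induction n as [|n IH]; intros a b; [simpl; ring|].
  rewrite conv_S_r, IH. simpl. ring.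
Qed.

Lemma conv_add_l (n : nat) : forall a b c : fps,
  conv (fadd a b) c n = (conv a c n + conv b c n)%C.
Proof.
  induction n as [|n IH]; intros a b c; simpl; [unfold fadd; ring|].
  change (shift (fadd a b)) with (fadd (shift a) (shift b)). rewrite IH. unfold fadd. ring.
Qed.

Lemma conv_fconst (n : nat) (c : C) (a : fps) : conv (fconst c) a n = (c * a n)%C.
Proof.
  assert (H0 : forall m b, conv (shift (fconst c)) b m = C0).
  { induction m as [|m IH]; intros b; simpl; [unfold shift; simpl; ring|].
    change (shift (shift (fconst c))) with (shift (fconst c)). rewrite IH.
    change (shift (fconst c) O) with C0. ring. }
  destruct n; simpl; [reflexivity|]. rewrite H0. ring.
Qed.

Lemma conv_scal_l (n : nat) (c : C) : forall a b : fps,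
  conv (fun i => c * a i)%C b n = (c * conv a b n)%C.
Proof.
  induction n as [|n IH]; intros a b; simpl; [ring|].
  change (shift (fun i => c * a i)%C) with (fun i => c * shift a i)%C. rewrite IH. ring.
Qed.

Lemma conv_assoc (n : nat) : forall a b c : fps,
  conv (conv a b) c n = conv a (conv b c) n.
Proof.
  induction n as [|n IH]; intros a b c; [simpl; ring|].
  simpl.
  change (shift (conv a b)) with (fadd (fun i => a O * shift b i)%C (conv (shift a) b)).
  rewrite conv_add_l, conv_scal_l, IH. ring.
Qed.

Lemma euler_conv (n : nat) : forall a b : fps,
  euler (conv a b) n = (conv (euler a) b n + conv a (euler b) n)%C.
Proof.
  induction n as [|n IH]; intros a b.
  - unfold euler. simpl. C_by_parts.
  - unfold euler at 1. rewrite S_INR, RtoC_add. fold C1. simpl conv.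
    change (shift (euler a)) with (fun i => RtoC (INR (S i)) * shift a i)%C.
    (* Shifting moves the weights by one: [(i+1) a_(i+1)] is the Euler derivative of [shift a] plus
       [shift a] itself. *)
    rewrite (conv_ext n (fun i => RtoC (INR (S i)) * shift a i)%C
      (fadd (euler (shift a)) (shift a)) b b); [|intros i _|reflexivity].
    2:{ rewrite S_INR, RtoC_add. fold C1. unfold fadd, euler. ring. }
    rewrite conv_add_l. specialize (IH (shift a) b). unfold euler at 1 in IH.
    transitivity ((RtoC (INR n) + C1) * (a O * b (S n)) + RtoC (INR n) * conv (shift a) b n
       + conv (shift a) b n)%C; [ring|].
    rewrite IH. unfold euler at 3 5. rewrite S_INR, RtoC_add. fold C1.
    change (INR 0) with 0. change (RtoC 0) with C0. ring.
Qed.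

Lemma fps_ring : ring_theory (fconst C0) (fconst C1) fadd conv fsub fopp (@eq fps).
Proof.
  split; intros; apply functional_extensionality; intros n.
  - unfold fadd. destruct n; simpl; ring.
  - unfold fadd. ring.
  - unfold fadd. ring.
  - rewrite conv_fconst. ring.
  - apply conv_comm.
  - symmetry. apply conv_assoc.
  - apply conv_add_l.
  - unfold fsub, fadd, fopp. ring.
  - unfold fadd, fopp. destruct n; simpl; ring.
Qed.

Add Ring fps_ring : fps_ring.

Lemma fsub_eq_0 (a b : fps) : fsub a b = fconst C0 -> a = b.
Proof.
  intros H. transitivity (fadd (fsub a b) b); [ring|]. rewrite H. ring.
Qed.

Lemma euler_mul (a b : fps) : euler (conv a b) = fadd (conv (euler a) b) (conv a (euler b)).
Proof. apply functional_extensionality; intros n. apply euler_conv. Qed.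

Lemma euler_sub (a b : fps) : euler (fsub a b) = fsub (euler a) (euler b).
Proof. apply functional_extensionality; intros n. unfold euler, fsub. ring. Qed.

Lemma conj_conv (n : nat) : forall a b : fps,
  Cconj (conv a b n) = conv (fconj a) (fconj b) n.
Proof.
  induction n as [|n IH]; intros a b; simpl; [apply Cconj_mul|].
  rewrite Cconj_add, Cconj_mul, IH. reflexivity.
Qed.

Lemma fconj_conv (a b : fps) : fconj (conv a b) = conv (fconj a) (fconj b).
Proof. apply functional_extensionality; intros n. apply conj_conv. Qed.

Lemma euler_conj (a : fps) : euler (fconj a) = fconj (euler a).
Proof. apply functional_extensionality; intros n. C_by_parts. Qed.

(** As [X] has no constant term, the equation expresses [n a_n] through the [a_i] with [i < n], and
    these vanish inductively. *)
Lemma euler_unique (X a : fps) :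
  X O = C0 -> a O = C0 -> euler a = conv X a -> a = fconst C0.
Proof.
  intros HX Ha H. apply functional_extensionality.
  intros n. induction n as [n IH] using lt_wf_ind. destruct n as [|n]; [exact Ha|].
  apply (Cmul_integral (RtoC (INR (S n)))).
  - change (euler a (S n) = C0). rewrite H. simpl conv. rewrite HX.
    rewrite (conv_ext n (shift X) (shift X) a (fconst C0)); [|reflexivity|].
    2:{ intros i Hi. apply IH. lia. }
    rewrite conv_comm, conv_fconst. ring.
  - intros H0. apply (f_equal Re) in H0. unfold RtoC in H0. cbn [Re C0] in H0.
    exact (not_0_INR (S n) ltac:(lia) H0).
Qed.

(** * Exponentials of power series *)

Fixpoint euler_sol_upto (X : fps) (n : nat) : fps :=
  match n with
  | O => fun _ => C1
  (* Course-of-values recursion through a growing table: entries up to [m] are copied, and entry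
     [S m] depends only on them. Entries beyond [S m] are fillers. *)
  | S m => fun k => if (k <=? m)%nat then euler_sol_upto X m k
           else (RtoC (/ INR (S m)) * conv (shift X) (euler_sol_upto X m) m)%C
  end.

(* The solution of [euler a = X a], [a 0 = 1], that is, the exponential of the
   series with coefficients [X n / n]. *)
Definition euler_sol (X : fps) : fps := fun k => euler_sol_upto X k k.

Lemma euler_sol_upto_stable (X : fps) (n k : nat) :
  (k <= n)%nat -> euler_sol_upto X n k = euler_sol X k.
Proof.
  induction n as [|n IH]; intros Hk.
  - replace k with O by lia. reflexivity.
  - destruct (Nat.eq_dec k (S n)) as [->|Hne]; [reflexivity|].
    simpl. destruct (Nat.leb_spec k n); [apply IH|]; lia.
Qed.

Lemma euler_sol_S (X : fps) (n : nat) :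
  euler_sol X (S n) = (RtoC (/ INR (S n)) * conv (shift X) (euler_sol X) n)%C.
Proof.
  unfold euler_sol at 1. cbn [euler_sol_upto].
  destruct (Nat.leb_spec (S n) n); [lia|]. f_equal. apply conv_ext; [reflexivity|].
  intros i Hi. apply euler_sol_upto_stable, Hi.
Qed.

Lemma euler_euler_sol (X : fps) : X O = C0 -> euler (euler_sol X) = conv X (euler_sol X).
Proof.
  intros HX. apply functional_extensionality. intros [|n].
  - unfold euler, euler_sol. simpl. rewrite HX. C_by_parts.
  - unfold euler. simpl conv. rewrite HX, euler_sol_S.
    transitivity (RtoC (INR (S n) * / INR (S n)) * conv (shift X) (euler_sol X) n)%C.
    + rewrite RtoC_mul. ring.
    + rewrite Rinv_r by (apply not_0_INR; lia). fold C1. ring.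
Qed.

(** * The factorization of [1 - s u] *)

Fixpoint Cpow (z : C) (n : nat) : C := match n with O => C1 | S m => (z * Cpow z m)%C end.

Definition one_minus (u : C) : fps :=
  fun n => match n with O => C1 | 1%nat => (- u)%C | _ => C0 end.

Lemma shift_one_minus (u : C) : shift (one_minus u) = fconst (- u)%C.
Proof. apply functional_extensionality. intros [|n]; reflexivity. Qed.

(** The logarithmic derivative of [1 - s u] under [s d/ds] is minus the sum of [u^n s^n] over
    [n >= 1], which is [- (A + conj A)]. *)
Lemma log_derivative_one_minus (u : C) (A : fps) :
  A O = C0 -> (forall n, (A (S n) + Cconj (A (S n)))%C = Cpow u (S n)) ->
  euler (one_minus u) = fopp (conv (one_minus u) (fadd A (fconj A))).
Proof.
  intros HA0 HA. apply functional_extensionality. intros [|n].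
  - unfold fopp, euler. simpl. unfold fadd, fconj. rewrite HA0. C_by_parts.
  - unfold fopp, euler. simpl conv. rewrite shift_one_minus, conv_fconst. unfold fadd, fconj.
    rewrite HA. destruct n as [|n].
    + rewrite HA0. C_by_parts.
    + rewrite HA. simpl. ring.
Qed.

Section Factorization.
Variables (u : C) (A : fps).
Hypothesis HA0 : A O = C0.
Hypothesis HA : forall n, (A (S n) + Cconj (A (S n)))%C = Cpow u (S n).

Let phi := euler_sol (fopp A).
Let psi := euler_sol (fconj A).

(** Both sides start with 1 and have logarithmic derivative [- A]: on the right, [- (A + conj A)]
    from [1 - s u] and [conj A] from [psi] add up to it. *)
Lemma spectral_factor_eq : phi = conv (one_minus u) psi.
Proof.
  pose proof (log_derivative_one_minus u A HA0 HA) as HG.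
  apply fsub_eq_0.
  apply (euler_unique (fopp A)).
  - unfold fopp. rewrite HA0. C_by_parts.
  - unfold fsub. simpl. unfold phi, psi, euler_sol. simpl. ring.
  - rewrite euler_sub, euler_mul.
    unfold phi, psi. rewrite !euler_euler_sol.
    + rewrite HG. ring.
    + unfold fconj. rewrite HA0. C_by_parts.
    + unfold fopp. rewrite HA0. C_by_parts.
Qed.

(** Again both sides start with 1 and share the logarithmic derivative [- (A + conj A)]. *)
Lemma spectral_factor_mul_conj : conv phi (fconj phi) = one_minus u.
Proof.
  pose proof (log_derivative_one_minus u A HA0 HA) as HG.
  apply fsub_eq_0.
  apply (euler_unique (fopp (fadd A (fconj A)))).
  - unfold fopp, fadd, fconj. rewrite HA0. C_by_parts.
  - unfold fsub, fconj. simpl. unfold phi, euler_sol. simpl. C_by_parts.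
  - rewrite euler_sub, euler_mul, euler_conj.
    assert (Hphi : euler phi = conv (fopp A) phi).
    { apply euler_euler_sol. unfold fopp. rewrite HA0. C_by_parts. }
    rewrite Hphi, fconj_conv.
    replace (fconj (fopp A)) with (fopp (fconj A))
      by (apply functional_extensionality; intros n; C_by_parts).
    rewrite HG. ring.
Qed.
End Factorization.

(** The truncation at [s = 1], written as the product with [1/(1-s)] so that ring identities for
    [conv] apply to partial sums. *)
Definition partial_sum (a : fps) (n : nat) : C := conv a (fun _ => C1) n.

Lemma partial_sum_S (a : fps) (n : nat) :
  partial_sum a (S n) = (partial_sum a n + a (S n))%C.
Proof. unfold partial_sum. rewrite conv_S_r. unfold shift. ring. Qed.

Lemma partial_sum_one_minus (u : C) (n : nat) :
  partial_sum (one_minus u) (S n) = (C1 - u)%C.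
Proof.
  unfold partial_sum. simpl. rewrite shift_one_minus, conv_fconst. simpl. ring.
Qed.

Lemma conv_const_sub (n : nat) (c : C) : forall a b : fps,
  conv a (fun m => c - b m)%C n = (partial_sum a n * c - conv a b n)%C.
Proof.
  unfold partial_sum.
  induction n as [|n IH]; intros a b; simpl; [ring|]. rewrite IH. ring.
Qed.

Lemma partial_sum_conj (a : fps) (n : nat) :
  partial_sum (fconj a) n = Cconj (partial_sum a n).
Proof.
  unfold partial_sum. rewrite conj_conv. f_equal.
  apply functional_extensionality. intros i. C_by_parts.
Qed.

(** * Geometric decay of convolutions, exponentials and tails *)

Section Estimates.
Variable sigma : R.
Hypothesis Hsigma : 0 <= sigma < 1.

(** The sum of [sigma^(2i) sigma^(n-i)] is at most [sigma^n / (1 - sigma)]: the faster decay of [a]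
    avoids a factor [n + 1]. [Ca] varies in the induction because shifting [a] multiplies it by
    [sigma^2]. *)
Lemma conv_bound_fast_slow (Cb : R) (n : nat) : forall (Ca : R) (a b : fps),
  0 <= Ca -> 0 <= Cb ->
  (forall i, Cabs (a i) <= Ca * (sigma ^ 2) ^ i) ->
  (forall i, (i <= n)%nat -> Cabs (b i) <= Cb * sigma ^ i) ->
  Cabs (conv a b n) <= Ca * Cb * sigma ^ n / (1 - sigma).
Proof.
  induction n as [|n IH]; intros Ca a b HCa HCb Ha Hb.
  - simpl. rewrite Cabs_mul. pose proof (Ha O) as Ha0. pose proof (Hb O ltac:(lia)) as Hb0.
    simpl in Ha0, Hb0. rewrite Rmult_1_r in *.
    pose proof (Cabs_ge_0 (a O)). pose proof (Cabs_ge_0 (b O)).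
    apply Rle_trans with (Ca * Cb); [apply Rmult_le_compat; lra|].
    assert (1 <= / (1 - sigma)) by (rewrite <- Rinv_1; apply Rinv_le_contravar; lra).
    assert (0 <= Ca * Cb) by (apply Rmult_le_pos; lra). unfold Rdiv. nra.
  - simpl conv. eapply Rle_trans; [apply Cabs_add|]. rewrite Cabs_mul.
    assert (H1 : Cabs (a O) * Cabs (b (S n)) <= Ca * (Cb * sigma ^ S n)).
    { apply Rmult_le_compat; try apply Cabs_ge_0; [|apply Hb; lia].
      pose proof (Ha O) as Ha0. simpl in Ha0. lra. }
    assert (H2 : Cabs (conv (shift a) b n) <= (Ca * sigma ^ 2) * Cb * sigma ^ n / (1 - sigma)).
    { apply IH; try assumption.
      - apply Rmult_le_pos; [lra | apply pow_le; lra].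
      - intros i. unfold shift. eapply Rle_trans; [apply Ha|]. simpl. lra.
      - intros i Hi. apply Hb. lia. }
    eapply Rle_trans; [apply Rplus_le_compat; [exact H1 | exact H2]|].
    right. simpl. field. lra.
Qed.

(** At equal decay rates all [n + 1] products have the same bound. *)
Lemma conv_bound (Cb : R) (n : nat) : forall (Ca : R) (a b : fps),
  0 <= Ca -> 0 <= Cb ->
  (forall i, (i <= n)%nat -> Cabs (a i) <= Ca * sigma ^ i) ->
  (forall i, (i <= n)%nat -> Cabs (b i) <= Cb * sigma ^ i) ->
  Cabs (conv a b n) <= INR (S n) * (Ca * Cb * sigma ^ n).
Proof.
  induction n as [|n IH]; intros Ca a b HCa HCb Ha Hb.
  - simpl. rewrite Cabs_mul. pose proof (Ha O ltac:(lia)) as Ha0.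
    pose proof (Hb O ltac:(lia)) as Hb0. simpl in Ha0, Hb0. rewrite Rmult_1_r in *.
    rewrite Rmult_1_l. apply Rmult_le_compat; try apply Cabs_ge_0; lra.
  - simpl conv. eapply Rle_trans; [apply Cabs_add|]. rewrite Cabs_mul.
    assert (H1 : Cabs (a O) * Cabs (b (S n)) <= Ca * (Cb * sigma ^ S n)).
    { apply Rmult_le_compat; try apply Cabs_ge_0; [|apply Hb; lia].
      pose proof (Ha O ltac:(lia)) as Ha0. simpl in Ha0. lra. }
    assert (H2 : Cabs (conv (shift a) b n) <= INR (S n) * ((Ca * sigma) * Cb * sigma ^ n)).
    { apply IH; try assumption.
      - apply Rmult_le_pos; lra.
      - intros i Hi. unfold shift. eapply Rle_trans; [apply Ha; lia|]. simpl. lra.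
      - intros i Hi. apply Hb. lia. }
    rewrite (S_INR (S n)).
    eapply Rle_trans; [apply Rplus_le_compat; [exact H1 | exact H2]|].
    right. simpl pow. ring.
Qed.

(** Running bound for [|a_n| / sigma^n], where [a] is an exponential whose recursion multiplies the
    bound by at most [Q / n] at step [n]; the maximum with 1 makes it monotone. *)
Fixpoint growth (Q : R) (n : nat) : R :=
  match n with O => 1 | S m => Rmax 1 (Q / INR (S m)) * growth Q m end.

Lemma growth_pos (Q : R) (n : nat) : 0 < growth Q n.
Proof.
  induction n as [|n IH]; cbn [growth]; [lra|].
  apply Rmult_lt_0_compat; [|exact IH]. eapply Rlt_le_trans; [|apply Rmax_l]. lra.
Qed.

Lemma growth_incr (Q : R) (n : nat) : growth Q n <= growth Q (S n).
Proof.
  cbn [growth]. pose proof (growth_pos Q n). pose proof (Rmax_l 1 (Q / INR (S n))). nra.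
Qed.

(** Once the index exceeds [Q], every further factor is 1. *)
Lemma growth_bounded (Q : R) : exists D, forall n, growth Q n <= D.
Proof.
  destruct (INR_unbounded Q) as [N HN]. exists (growth Q N).
  assert (Hle : forall k, growth Q (N + k) <= growth Q N).
  { induction k as [|k IH]; [rewrite Nat.add_0_r; lra|].
    rewrite Nat.add_succ_r. cbn [growth]. rewrite Rmax_left; [lra|].
    assert (HN' : INR N <= INR (S (N + k))) by (apply le_INR; lia).
    assert (0 < INR (S (N + k))) by (apply lt_0_INR; lia).
    apply Rmult_le_reg_r with (INR (S (N + k))); [lra|].
    unfold Rdiv. rewrite Rmult_assoc, Rinv_l by lra. lra. }
  assert (Hge : forall k n, growth Q n <= growth Q (n + k)).
  { induction k as [|k IH]; intros n; [rewrite Nat.add_0_r; lra|].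
    rewrite Nat.add_succ_r. eapply Rle_trans; [apply IH | apply growth_incr]. }
  intros n. destruct (Nat.le_ge_cases n N) as [H|H].
  - replace N with (n + (N - n))%nat by lia. apply Hge.
  - replace n with (N + (n - N))%nat by lia. apply Hle.
Qed.

(** [D] is chosen before [X], which later makes the bound uniform over the torus. *)
Lemma euler_sol_bound (Ca : R) : 0 <= Ca -> exists D, 0 <= D /\ forall X : fps,
  (forall i, Cabs (X i) <= Ca * (sigma ^ 2) ^ i) ->
  forall n, Cabs (euler_sol X n) <= D * sigma ^ n.
Proof.
  intros HCa. set (Q := Ca * sigma / (1 - sigma)).
  destruct (growth_bounded Q) as [D HD]. exists D. split.
  { pose proof (HD O) as H. simpl in H. lra. }
  intros X HX.
  assert (H : forall n i, (i <= n)%nat -> Cabs (euler_sol X i) <= growth Q n * sigma ^ i).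
  { induction n as [|n IH]; intros i Hi.
    - replace i with O by lia. unfold euler_sol. simpl. rewrite Cabs_C1. lra.
    - destruct (Nat.eq_dec i (S n)) as [->|Hne].
      + rewrite euler_sol_S, Cabs_mul, Cabs_RtoC.
        assert (HS : 0 < INR (S n)) by (apply lt_0_INR; lia).
        assert (HS' : 0 < / INR (S n)) by (apply Rinv_0_lt_compat; lra).
        rewrite Rabs_pos_eq by lra.
        assert (Hc : Cabs (conv (shift X) (euler_sol X) n)
            <= (Ca * sigma ^ 2) * growth Q n * sigma ^ n / (1 - sigma)).
        { apply conv_bound_fast_slow.
          - apply Rmult_le_pos; [lra | apply pow_le; lra].
          - left. apply growth_pos.
          - intros j. unfold shift. eapply Rle_trans; [apply HX|]. simpl. lra.
          - exact IH. }
        (* [Q] is chosen so that [Ca sigma^2 sigma^n / (1 - sigma) = Q sigma^(n+1)]. *)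
        apply Rle_trans with (Q / INR (S n) * growth Q n * sigma ^ S n).
        * eapply Rle_trans; [apply Rmult_le_compat_l; [lra | exact Hc]|].
          right. unfold Q. simpl pow. field. lra.
        * apply Rmult_le_compat_r; [apply pow_le; lra|]. cbn [growth].
          apply Rmult_le_compat_r; [left; apply growth_pos | apply Rmax_r].
      + eapply Rle_trans; [apply IH; lia|].
        apply Rmult_le_compat_r; [apply pow_le; lra | apply growth_incr]. }
  intros n. eapply Rle_trans; [apply H, le_n|].
  apply Rmult_le_compat_r; [apply pow_le; lra | apply HD].
Qed.

Lemma partial_sum_tail (D : R) (b : fps) (m k : nat) :
  0 <= D -> (forall i, Cabs (b i) <= D * sigma ^ i) ->
  Cabs (partial_sum b (m + k) - partial_sum b m)
  <= D / (1 - sigma) * (sigma ^ m - sigma ^ (m + k)).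
Proof.
  intros HD Hb. induction k as [|k IH].
  - rewrite Nat.add_0_r.
    replace (partial_sum b m - partial_sum b m)%C with C0 by ring. rewrite Cabs_C0. lra.
  - rewrite Nat.add_succ_r, partial_sum_S.
    replace (partial_sum b (m + k) + b (S (m + k)) - partial_sum b m)%C
      with (partial_sum b (m + k) - partial_sum b m + b (S (m + k)))%C by ring.
    eapply Rle_trans; [apply Cabs_add|].
    assert (Hp : 0 <= sigma ^ (m + k)) by (apply pow_le; lra).
    assert (Hstep : D * sigma ^ S (m + k)
       <= D / (1 - sigma) * (sigma ^ (m + k) - sigma ^ S (m + k))).
    { replace (sigma ^ (m + k) - sigma ^ S (m + k)) with ((1 - sigma) * sigma ^ (m + k))
        by (simpl; ring).
      replace (D / (1 - sigma) * ((1 - sigma) * sigma ^ (m + k))) with (D * sigma ^ (m + k))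
        by (field; lra).
      apply Rmult_le_compat_l; [lra|]. simpl. nra. }
    specialize (Hb (S (m + k))). lra.
Qed.

(** The difference is the sum of [a_i] times the tail of [b] between [n - i] and [n]; both factors
    decay like powers of [sigma], with exponents adding up to [n]. *)
Lemma partial_sum_mul (D : R) (a b : fps) (n : nat) :
  0 <= D -> (forall i, Cabs (a i) <= D * sigma ^ i) -> (forall i, Cabs (b i) <= D * sigma ^ i) ->
  Cabs (partial_sum a n * partial_sum b n - partial_sum (conv a b) n)
  <= INR (S n) * (D * (D / (1 - sigma)) * sigma ^ n).
Proof.
  intros HD Ha Hb.
  assert (HD' : 0 <= D / (1 - sigma)).
  { apply Rmult_le_pos; [lra|]. left. apply Rinv_0_lt_compat. lra. }
  replace (partial_sum a n * partial_sum b n - partial_sum (conv a b) n)%C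
    with (conv a (fun m => partial_sum b n - partial_sum b m)%C n).
  - apply conv_bound; auto. intros m Hm.
    replace n with (m + (n - m))%nat by lia.
    eapply Rle_trans; [apply (partial_sum_tail D); assumption|].
    apply Rmult_le_compat_l; [exact HD'|].
    assert (0 <= sigma ^ (m + (n - m))) by (apply pow_le; lra). lra.
  - rewrite conv_const_sub. f_equal. symmetry. apply conv_assoc.
Qed.
End Estimates.

(** * Spectral factorization *)

Lemma TrigPolyF_opp (S : Z * Z -> Prop) (f : R -> R -> C) :
  TrigPolyF S f -> TrigPolyF S (fun x y => - f x y)%C.
Proof.
  intros H. apply TrigPolyF_ext with (fun x y => - C1 * f x y)%C; [intros; ring|].
  apply TrigPolyF_mul with (eq (0, 0)%Z) S; [|apply TrigPolyF_const; reflexivity|exact H].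
  intros m [j k] <-. trivial.
Qed.

Lemma TrigPolyF_conv (S : Z * Z -> Prop) (n : nat) :
  (forall k m, S k -> S m -> S (Zpair_add k m)) -> forall a b : R -> R -> fps,
  (forall i, (i <= n)%nat -> TrigPolyF S (fun x y => a x y i)) ->
  (forall i, (i <= n)%nat -> TrigPolyF S (fun x y => b x y i)) ->
  TrigPolyF S (fun x y => conv (a x y) (b x y) n).
Proof.
  intros HS. induction n as [|n IH]; intros a b Ha Hb; simpl.
  - apply TrigPolyF_mul with S S; auto.
  - apply TrigPolyF_add.
    + apply TrigPolyF_mul with S S; [exact HS | apply Ha; lia | apply Hb; lia].
    + apply (IH (fun x y => shift (a x y)) b).
      * intros i Hi. apply (Ha (Datatypes.S i)). lia.
      * intros i Hi. apply Hb. lia.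
Qed.

(** The recursion builds each coefficient from sums and products of coefficients of [X], so any
    additive submonoid of frequencies is preserved. *)
Lemma TrigPolyF_euler_sol (S : Z * Z -> Prop) (X : R -> R -> fps) :
  S (0, 0)%Z -> (forall k m, S k -> S m -> S (Zpair_add k m)) ->
  (forall n, TrigPolyF S (fun x y => X x y n)) ->
  forall n, TrigPolyF S (fun x y => euler_sol (X x y) n).
Proof.
  intros H0 HS HX n. induction n as [n IH] using lt_wf_ind. destruct n as [|n].
  - exact (TrigPolyF_const S C1 H0).
  - apply TrigPolyF_ext with
      (fun x y => RtoC (/ INR (Datatypes.S n)) * conv (shift (X x y)) (euler_sol (X x y)) n)%C.
    { intros. symmetry. apply euler_sol_S. }
    apply TrigPolyF_mul with S S; [exact HS | apply TrigPolyF_const, H0 |].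
    apply (TrigPolyF_conv S n HS (fun x y => shift (X x y)) (fun x y => euler_sol (X x y))).
    + intros i _. apply HX.
    + intros i Hi. apply IH. lia.
Qed.

Lemma TrigPolyF_partial_sum (S : Z * Z -> Prop) (a : R -> R -> fps) (n : nat) :
  (forall i, TrigPolyF S (fun x y => a x y i)) ->
  TrigPolyF S (fun x y => partial_sum (a x y) n).
Proof.
  intros Ha. induction n as [|n IH].
  - apply TrigPolyF_ext with (fun x y => a x y O); [|apply Ha].
    intros. unfold partial_sum. simpl. ring.
  - apply TrigPolyF_ext with (fun x y => partial_sum (a x y) n + a x y (Datatypes.S n))%C.
    + intros. symmetry. apply partial_sum_S.
    + apply TrigPolyF_add; [exact IH | apply Ha].
Qed.

(** * Powers of a trigonometric polynomial *)

Fixpoint tp_pow (l : list term) (n : nat) : list term :=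
  match n with O => [((0, 0)%Z, C1)] | S m => tp_mul l (tp_pow l m) end.

Lemma tp_eval_pow (l : list term) (n : nat) (x y : R) :
  tp_eval (tp_pow l n) x y = Cpow (tp_eval l x y) n.
Proof.
  induction n as [|n IH].
  - simpl tp_pow. rewrite tp_eval_cons, character_0.
    change (tp_eval [] x y) with C0. simpl. ring.
  - simpl tp_pow. rewrite tp_eval_mul, IH. reflexivity.
Qed.

Lemma freq_in_box_pow (l : list term) (D n : nat) :
  freq_in (box D) l -> freq_in (box (n * D)) (tp_pow l n).
Proof.
  intros H. induction n as [|n IH].
  - constructor; [split; simpl; lia | constructor].
  - simpl tp_pow. eapply freq_in_mul; [|exact H|exact IH].
    intros [j k] [j' k']. unfold box, Zpair_add. simpl. lia.
Qed.

Lemma freq_in_some_box (l : list term) : exists D, freq_in (box D) l.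
Proof.
  induction l as [|[[j k] c] l [D IH]]; [exists O; constructor|].
  exists (D + Z.to_nat (Z.abs j + Z.abs k))%nat. constructor.
  - unfold box. simpl. lia.
  - eapply freq_in_impl; [|exact IH]. unfold box. intros n. lia.
Qed.

(** * Geometric decay against polynomial growth *)

Lemma linear_geometric_bound (t : R) (n : nat) :
  0 <= t <= 1 -> INR (S n) * t ^ n * (1 - t) <= 1 - t ^ S n.
Proof.
  (* Divided by [1 - t], the claim says that [1 + t + ... + t^n] has [n + 1] terms, each at least
     [t^n]. *)
  intros Ht. induction n as [|n IH]; [simpl; lra|].
  rewrite (S_INR (S n)).
  assert (0 <= t ^ S n <= 1).
  { split; [apply pow_le; lra|]. rewrite <- (pow1 (S n)). apply pow_incr. lra. }
  replace ((INR (S n) + 1) * t ^ S n * (1 - t))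
    with (t * (INR (S n) * t ^ n * (1 - t)) + t ^ S n * (1 - t)) by (simpl pow; ring).
  change (t ^ S (S n)) with (t * t ^ S n). nra.
Qed.

Lemma sqrt_between_0_1 (q : R) : 0 < q < 1 -> 0 < sqrt q < 1.
Proof.
  intros Hq. split; [apply sqrt_lt_R0; lra|]. rewrite <- sqrt_1. apply sqrt_lt_1; lra.
Qed.

(** With [q = t^4], one has [q^n = (sqrt q)^n (t^n)^2], and [(n+1) t^n] is at most [1/(1-t)]. *)
Lemma quadratic_geometric_bound (q : R) : 0 < q < 1 ->
  exists K, 0 <= K /\ forall n, INR (S n) ^ 2 * q ^ n <= K * sqrt q ^ n.
Proof.
  intros Hq. set (s := sqrt q). set (t := sqrt s).
  assert (Hs : 0 < s < 1) by (apply sqrt_between_0_1, Hq).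
  assert (Ht : 0 < t < 1) by (apply sqrt_between_0_1, Hs).
  assert (Es : s = t * t) by (unfold t; rewrite sqrt_sqrt; lra).
  assert (Eq : q = s * s) by (unfold s; rewrite sqrt_sqrt; lra).
  exists (/ (1 - t) ^ 2). split; [left; apply Rinv_0_lt_compat, pow_lt; lra|].
  intros n. rewrite Eq, Rpow_mult_distr, <- Rmult_assoc.
  apply Rmult_le_compat_r; [apply pow_le; lra|].
  rewrite Es, Rpow_mult_distr.
  pose proof (linear_geometric_bound t n ltac:(lra)) as H.
  assert (0 <= t ^ S n) by (apply pow_le; lra).
  assert (Hp : 0 <= INR (S n) * t ^ n * (1 - t)).
  { repeat apply Rmult_le_pos; [apply pos_INR | apply pow_le; lra | lra]. }
  apply Rmult_le_reg_r with ((1 - t) ^ 2); [apply pow_lt; lra|].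
  rewrite Rinv_l by (apply pow_nonzero; lra).
  replace (INR (S n) ^ 2 * (t ^ n * t ^ n) * (1 - t) ^ 2)
    with ((INR (S n) * t ^ n * (1 - t)) ^ 2) by ring.
  nra.
Qed.

Lemma linear_geometric_small (c q eps : R) : 0 <= c -> 0 < q < 1 -> 0 < eps ->
  exists N, forall n, (N <= n)%nat -> INR (S n) * (c * q ^ n) < eps.
Proof.
  intros Hc Hq Heps. destruct (quadratic_geometric_bound q Hq) as [K [HK HKn]].
  pose proof (sqrt_between_0_1 q Hq) as Hs.
  assert (HcK : 0 <= c * K) by (apply Rmult_le_pos; lra).
  destruct (pow_lt_1_zero (sqrt q)) with (y := eps / (c * K + 1)) as [N HN].
  - rewrite Rabs_pos_eq; lra.
  - apply Rmult_lt_0_compat; [lra | apply Rinv_0_lt_compat; lra].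
  - exists N. intros n Hn. specialize (HN n Hn). specialize (HKn n).
    assert (Hp : 0 <= sqrt q ^ n) by (apply pow_le; lra).
    rewrite Rabs_pos_eq in HN by exact Hp.
    assert (Hlt : (c * K + 1) * sqrt q ^ n < eps).
    { apply Rmult_lt_compat_l with (r := c * K + 1) in HN; [|lra].
      replace ((c * K + 1) * (eps / (c * K + 1))) with eps in HN by (field; lra). exact HN. }
    assert (H1 : 1 <= INR (S n)) by (rewrite S_INR; pose proof (pos_INR n); lra).
    assert (Hqn : 0 <= q ^ n) by (apply pow_le; lra).
    assert (INR (S n) * q ^ n <= INR (S n) ^ 2 * q ^ n) by (apply Rmult_le_compat_r; nra).
    nra.
Qed.

(** * Levels and folding onto nonnegative levels *)

Definition level (alpha : R) (n : Z * Z) : R := IZR (snd n) - IZR (fst n) * alpha.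

Lemma level_add (alpha : R) (m n : Z * Z) :
  level alpha (Zpair_add m n) = level alpha m + level alpha n.
Proof. unfold level. simpl. rewrite !plus_IZR. ring. Qed.

Lemma level_opp (alpha : R) (n : Z * Z) : level alpha (Zpair_opp n) = - level alpha n.
Proof. unfold level. simpl. rewrite !opp_IZR. ring. Qed.

Lemma level_0 (alpha : R) : level alpha (0, 0)%Z = 0.
Proof. unfold level. simpl. ring. Qed.

(* Moving a term of negative level to the opposite frequency, with conjugate
   coefficient, leaves the real part of the polynomial unchanged; because of the factor 1/2, the
   result plus its conjugate is that real part. *)
Definition fold_term (alpha : R) (t : term) : term :=
  if Rle_dec 0 (level alpha (fst t)) then (fst t, (RtoC (/ 2) * snd t)%C)
  else (Zpair_opp (fst t), (RtoC (/ 2) * Cconj (snd t))%C).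

Definition tp_fold (alpha : R) (l : list term) : list term := map (fold_term alpha) l.

Lemma freq_in_fold (alpha : R) (l : list term) :
  freq_in (fun n => 0 <= level alpha n) (tp_fold alpha l).
Proof.
  apply Forall_map, Forall_forall. intros t _. unfold fold_term.
  destruct (Rle_dec 0 (level alpha (fst t))); simpl; [assumption|]. rewrite level_opp. lra.
Qed.

Lemma tp_norm_fold (alpha : R) (l : list term) :
  tp_norm (tp_fold alpha l) = tp_norm l / 2.
Proof.
  induction l as [|t l IH]; [simpl; field|].
  simpl tp_fold. change (tp_norm (fold_term alpha t :: tp_fold alpha l) = tp_norm (t :: l) / 2).
  simpl tp_norm. fold (tp_norm (tp_fold alpha l)) (tp_norm l). rewrite IH. unfold fold_term.
  destruct (Rle_dec 0 (level alpha (fst t))); simpl snd;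
    rewrite Cabs_mul, ?Cabs_conj, Cabs_RtoC, Rabs_pos_eq by lra; field.
Qed.

Lemma tp_eval_fold (alpha : R) (l : list term) (x y : R) :
  (tp_eval (tp_fold alpha l) x y + Cconj (tp_eval (tp_fold alpha l) x y))%C
  = RtoC (Re (tp_eval l x y)).
Proof.
  induction l as [|[n c] l IH]; [C_by_parts|].
  change (tp_fold alpha ((n, c) :: l)) with (fold_term alpha (n, c) :: tp_fold alpha l).
  rewrite tp_eval_cons. cbn [Re Cadd]. rewrite RtoC_add, <- IH. clear IH.
  set (f := tp_eval (tp_fold alpha l) x y).
  unfold fold_term. simpl fst. simpl snd.
  destruct (Rle_dec 0 (level alpha n)); rewrite tp_eval_cons, ?character_opp; fold f;
    generalize (character n x y); intros z; apply C_ext; simpl; field.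
Qed.

Lemma Cpow_RtoC (r : R) (n : nat) : Cpow (RtoC r) n = RtoC (r ^ n).
Proof. induction n as [|n IH]; simpl; [reflexivity|]. rewrite IH, RtoC_mul. reflexivity. Qed.

(* The coefficients, in powers of s, of minus s d/ds of the part of
   [log (1 - s u)] with nonnegative levels. *)
Definition folded_powers (alpha : R) (l : list term) (x y : R) : fps := fun n =>
  match n with O => C0 | S _ => tp_eval (tp_fold alpha (canon (tp_pow l n))) x y end.

(** [u^n] has sup norm at most [rho^n] and frequencies in a box of side linear in [n]; replacing
    [rho] by its square root absorbs the quadratic number of terms. *)
Lemma folded_powers_bound (alpha rho : R) (l : list term) : 0 < rho < 1 ->
  (forall x y, exists r, tp_eval l x y = RtoC r /\ 0 <= r <= rho) ->
  exists K, 0 <= K /\ forall x y n, Cabs (folded_powers alpha l x y n) <= K * sqrt rho ^ n.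
Proof.
  intros Hrho Hu. destruct (freq_in_some_box l) as [D HD].
  destruct (quadratic_geometric_bound rho Hrho) as [K [HK HKn]].
  assert (HE : 0 <= INR (2 * D + 1) ^ 2) by apply pow2_ge_0.
  exists (INR (2 * D + 1) ^ 2 * K). split; [apply Rmult_le_pos; assumption|].
  intros x y n.
  assert (Hs : 0 <= sqrt rho ^ n) by (apply pow_le, sqrt_pos).
  destruct n as [|n].
  - simpl folded_powers. rewrite Cabs_C0. apply Rmult_le_pos; [apply Rmult_le_pos|]; assumption.
  - unfold folded_powers. set (m := S n) in *.
    eapply Rle_trans; [apply tp_eval_bound|]. rewrite tp_norm_fold.
    assert (HM : tp_norm (canon (tp_pow l m)) <= INR (2 * (m * D) + 1) ^ 2 * rho ^ m).
    { apply canon_norm_bound; [apply freq_in_box_pow, HD|].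
      intros x' y'. destruct (Hu x' y') as [r [Hr Hr']].
      rewrite tp_eval_pow, Hr, Cpow_RtoC, Cabs_RtoC, Rabs_pos_eq by (apply pow_le; lra).
      apply pow_incr. exact Hr'. }
    assert (Hsize : INR (2 * (m * D) + 1) ^ 2 <= INR (2 * D + 1) ^ 2 * INR (S m) ^ 2).
    { rewrite <- Rpow_mult_distr. apply pow_incr. split; [apply pos_INR|].
      rewrite <- mult_INR. apply le_INR. nia. }
    assert (Hr : 0 <= rho ^ m) by (apply pow_le; lra).
    assert (H0 : 0 <= INR (2 * (m * D) + 1) ^ 2 * rho ^ m)
      by (apply Rmult_le_pos; [apply pow2_ge_0 | exact Hr]).
    apply Rle_trans with (INR (2 * D + 1) ^ 2 * (INR (S m) ^ 2 * rho ^ m)).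
    + apply Rmult_le_compat_r with (r := rho ^ m) in Hsize; [|exact Hr]. lra.
    + rewrite Rmult_assoc. apply Rmult_le_compat_l; [exact HE | apply HKn].
Qed.

Lemma folded_powers_eq (alpha : R) (l : list term) (x y : R) (n : nat) :
  Im (tp_eval l x y) = 0 ->
  (folded_powers alpha l x y (S n) + Cconj (folded_powers alpha l x y (S n)))%C
  = Cpow (tp_eval l x y) (S n).
Proof.
  intros Him. unfold folded_powers. rewrite tp_eval_fold, tp_eval_canon, tp_eval_pow.
  assert (Hr : tp_eval l x y = RtoC (Re (tp_eval l x y))).
  { apply C_ext; [reflexivity | exact Him]. }
  rewrite Hr, Cpow_RtoC. reflexivity.
Qed.

(** The normalized case: [1 - u] is bounded away from 0, so the series for the spectral factor
    converges geometrically, uniformly on the torus. *)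
Lemma spectral_approximation (alpha rho Lmax : R) (l : list term) :
  0 < rho < 1 -> 0 <= Lmax -> freq_in (fun n => level alpha n <= Lmax) l ->
  (forall x y, exists r, tp_eval l x y = RtoC r /\ 0 <= r <= rho) ->
  forall eps, 0 < eps -> exists p,
    TrigPolyF (fun n => 0 <= level alpha n /\ level alpha n <= Lmax) p /\
    forall x y, Cabs (C1 - tp_eval l x y - RtoC (Cabs2 (p x y))) < eps.
Proof.
  intros Hrho HL Hfreq Hu eps Heps.
  set (A := folded_powers alpha l).
  set (phi := fun x y => euler_sol (fopp (A x y))).
  set (psi := fun x y => euler_sol (fconj (A x y))).
  assert (HA : forall x y n, (A x y (S n) + Cconj (A x y (S n)))%C = Cpow (tp_eval l x y) (S n)).
  { intros x y n. apply folded_powers_eq. destruct (Hu x y) as [r [-> _]]. reflexivity. }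
  assert (HAS : forall n, TrigPolyF (fun n => 0 <= level alpha n) (fun x y => A x y n)).
  { intros [|n].
    - apply (TrigPolyF_const _ C0). rewrite level_0. lra.
    - exists (tp_fold alpha (canon (tp_pow l (S n)))). split; [apply freq_in_fold | reflexivity]. }
  assert (Hpsi : forall n, TrigPolyF (fun n => level alpha n <= 0) (fun x y => psi x y n)).
  { apply TrigPolyF_euler_sol.
    - rewrite level_0. lra.
    - intros k m. rewrite level_add. lra.
    - intros n. eapply TrigPolyF_conj; [|apply HAS]. intros m. simpl. rewrite level_opp. lra. }
  assert (Hphi : forall n, TrigPolyF (fun n => 0 <= level alpha n /\ level alpha n <= Lmax)
      (fun x y => phi x y n)).
  (* The lower bound comes from [phi] as an exponential of nonnegative levels, the upper one from
     [phi = (1 - s u) psi], where [u] has levels at most [Lmax] and [psi] at most 0. *)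
  { intros n. apply TrigPolyF_inter.
    - apply TrigPolyF_euler_sol.
      + rewrite level_0. lra.
      + intros k m. rewrite level_add. lra.
      + intros k. apply TrigPolyF_opp, HAS.
    - apply TrigPolyF_ext with (fun x y => conv (one_minus (tp_eval l x y)) (psi x y) n).
      { intros x y. symmetry. unfold phi, psi.
        rewrite (spectral_factor_eq (tp_eval l x y)); auto. }
      assert (Hpsi' : forall k, TrigPolyF (fun n => level alpha n <= Lmax) (fun x y => psi x y k)).
      { intros k. eapply TrigPolyF_impl; [|apply Hpsi]. simpl. intros m. lra. }
      destruct n as [|n].
      + apply TrigPolyF_ext with (fun x y => psi x y O); [intros; simpl; ring | apply Hpsi'].
      + apply TrigPolyF_ext with
          (fun x y => psi x y (S n) + - (tp_eval l x y * psi x y n))%C.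
        { intros x y. simpl conv. rewrite shift_one_minus, conv_fconst. ring. }
        apply TrigPolyF_add; [apply Hpsi'|]. apply TrigPolyF_opp.
        eapply TrigPolyF_mul; [|exists l; split; [exact Hfreq | reflexivity]|apply Hpsi].
        intros k m. simpl. rewrite level_add. lra. }
  (* [A] decays like powers of [sqrt rho], and [euler_sol_bound] needs this rate to be [sigma^2]. *)
  set (sigma := sqrt (sqrt rho)).
  pose proof (sqrt_between_0_1 rho Hrho) as Hs.
  assert (Hsigma : 0 < sigma < 1) by (apply sqrt_between_0_1, Hs).
  assert (Hsigma2 : sigma ^ 2 = sqrt rho).
  { unfold sigma. rewrite <- Rsqr_pow2. apply Rsqr_sqrt. lra. }
  destruct (folded_powers_bound alpha rho l Hrho Hu) as [K [HK HKn]].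
  destruct (euler_sol_bound sigma ltac:(lra) K HK) as [D [HD HDn]].
  assert (Hphib : forall x y n, Cabs (phi x y n) <= D * sigma ^ n).
  { intros x y. apply HDn. intros i. unfold fopp. rewrite Cabs_opp, Hsigma2. apply HKn. }
  destruct (linear_geometric_small (D * (D / (1 - sigma))) sigma eps) as [N HN]; try lra.
  { repeat apply Rmult_le_pos; try lra. left. apply Rinv_0_lt_compat. lra. }
  (* The index is at least 1, so that the partial sum of [1 - s u] is already [1 - u]. *)
  exists (fun x y => partial_sum (phi x y) (S N)). split.
  - apply TrigPolyF_partial_sum, Hphi.
  - intros x y. rewrite <- Cmul_conj, <- partial_sum_conj, <- (partial_sum_one_minus _ N).
    unfold phi at 1 2. rewrite <- (spectral_factor_mul_conj (tp_eval l x y) (A x y)) by auto.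
    fold (phi x y).
    rewrite <- Cabs_opp.
    eapply Rle_lt_trans; [|apply (HN (S N)); lia].
    eapply Rle_trans; [|apply (partial_sum_mul sigma ltac:(lra) D (phi x y) (fconj (phi x y)))].
    + right. f_equal. ring.
    + exact HD.
    + apply Hphib.
    + intros i. unfold fconj. rewrite Cabs_conj. apply Hphib.
Qed.

(** The bound is kept as a difference of levels of two members of [F], replaced whenever a larger
    level appears; [o] supplies the initial bound 0. *)
Lemma diffset_level_bound (alpha : R) (F : Z * Z -> Prop) (l : list term) (o : Z * Z) :
  F o -> freq_in (diffset F) l -> exists a b, F a /\ F b /\ level alpha b <= level alpha a /\
    freq_in (fun n => level alpha n <= level alpha a - level alpha b) l.
Proof.
  intros Ho H. induction H as [|t l Ht H IH].
  - exists o, o. repeat split; [assumption|assumption|lra|constructor].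
  - destruct IH as [a [b [Ha [Hb [Hab IH]]]]].
    destruct Ht as [c [d [Hc [Hd Ht]]]].
    assert (Et : level alpha (fst t) = level alpha c - level alpha d).
    { rewrite Ht. unfold level. simpl. rewrite !minus_IZR. ring. }
    destruct (Rle_dec (level alpha (fst t)) (level alpha a - level alpha b)) as [Hle|Hle].
    + exists a, b. repeat split; try assumption. constructor; assumption.
    + exists c, d. repeat split; try assumption; [lra|]. constructor; [lra|].
      eapply Forall_impl; [|exact IH]. simpl. intros n. lra.
Qed.

Lemma T2plus_U2 (alpha beta : R) (t : R -> R -> C) : 0 < beta ->
  T2plus (diffset (F2 alpha beta)) t -> U2 (F2 alpha beta) t.
Proof.
  intros Hbeta [[l [Hl Et]] Hpos]. split; [exists l; exact Et|].
  intros eps Heps.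
  destruct (diffset_level_bound alpha (F2 alpha beta) l (0, 0)%Z) as [a [b [Ha [Hb [Hab Hlev]]]]].
  { unfold F2. simpl. rewrite Rmult_0_l, Rminus_0_r, Rabs_R0. exact Hbeta. }
  { exact Hl. }
  assert (Hn : 0 <= tp_norm l).
  { eapply Rle_trans; [apply Cabs_ge_0 | apply (tp_eval_bound l 0 0)]. }
  (* [B] exceeds the sup norm of [t] by [eps], so [u = 1 - (t + eps/2)/B] is nonnegative; and
     [t >= 0] gives [u <= rho]. *)
  set (B := tp_norm l + eps).
  assert (HB : 0 < B) by (unfold B; lra).
  assert (HBi : 0 < / B) by (apply Rinv_0_lt_compat; lra).
  set (rho := 1 - eps / 2 / B).
  assert (Hrho : 0 < rho < 1).
  { assert (0 < eps / 2 / B) by (apply Rmult_lt_0_compat; lra).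
    assert (eps / 2 / B < 1).
    { apply Rmult_lt_reg_r with B; [lra|]. unfold Rdiv at 1.
      rewrite Rmult_assoc, Rinv_l by lra. unfold B. lra. }
    unfold rho. lra. }
  (* A list for [u], whose constant part [1 - (eps/2)/B] is exactly [rho]. *)
  set (lu := ((0, 0)%Z, RtoC rho) :: tp_mul [((0, 0)%Z, RtoC (- / B))] l).
  assert (Eu : forall x y, tp_eval lu x y = RtoC (1 - (Re (t x y) + eps / 2) / B)).
  { intros x y. unfold lu. rewrite tp_eval_cons, tp_eval_mul, tp_eval_cons, character_0, <- Et.
    change (tp_eval [] x y) with C0. destruct (Hpos x y) as [Him _].
    apply C_ext; simpl; rewrite ?Him; unfold rho; field; lra. }
  destruct (spectral_approximation alpha rho (level alpha a - level alpha b) lu)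
    with (eps := eps / 2 / B) as [p [Hp Hpeps]]; try assumption.
  - lra.
  - constructor; [simpl fst; rewrite level_0; lra|].
    change (freq_in (fun n => level alpha n <= level alpha a - level alpha b)
      (tp_mul [((0, 0)%Z, RtoC (- / B))] l)).
    apply freq_in_mul with (eq (0, 0)%Z) (fun n => level alpha n <= level alpha a - level alpha b);
      [|repeat constructor|exact Hlev].
    intros m [j k] <-. trivial.
  - intros x y. exists (1 - (Re (t x y) + eps / 2) / B). split; [apply Eu|].
    destruct (Hpos x y) as [_ Hre].
    pose proof (tp_eval_bound l x y) as Hb1. rewrite <- Et in Hb1.
    pose proof (Rabs_Re_le (t x y)) as Hb2. rewrite Rabs_pos_eq in Hb2 by exact Hre.
    unfold rho. split.
    + apply Rmult_le_reg_r with B; [lra|].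
      replace ((1 - (Re (t x y) + eps / 2) / B) * B) with (B - (Re (t x y) + eps / 2))
        by (field; lra). unfold B. lra.
    + unfold Rdiv. nra.
  - apply Rmult_lt_0_compat; lra.
  (* The factor [sqrt B] undoes the scaling; the character of [b] moves levels from
     [[0, level a - level b]] to [[level b, level a]], inside the open strip, without changing the
     modulus. *)
  - exists (fun x y => RtoC (sqrt B) * character b x y * p x y)%C. split.
    + apply TrigPolyF_mul with (eq b) (fun n => 0 <= level alpha n /\
        level alpha n <= level alpha a - level alpha b).
      * intros m n <- Hn'. unfold F2 in *. fold (level alpha a) in Ha.
        fold (level alpha b) in Hb. fold (level alpha (Zpair_add b n)). rewrite level_add.
        apply Rabs_def2 in Ha, Hb. apply Rabs_def1; lra.
      * apply TrigPolyF_monomial. reflexivity.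
      * exact Hp.
    + intros x y. specialize (Hpeps x y). rewrite Eu in Hpeps.
      destruct (Hpos x y) as [Him Hre].
      assert (E2 : Cabs2 (RtoC (sqrt B) * character b x y * p x y)%C = B * Cabs2 (p x y)).
      { assert (Hm : forall z w, Cabs2 (z * w)%C = Cabs2 z * Cabs2 w)
          by (intros; unfold Cabs2; simpl; ring).
        rewrite !Hm. unfold character. rewrite Cabs2_e2pi. unfold Cabs2 at 1. simpl Re. simpl Im.
        transitivity (sqrt B * sqrt B * Cabs2 (p x y)); [ring|].
        rewrite sqrt_sqrt by lra. reflexivity. }
      rewrite E2.
      set (d := 1 - (1 - (Re (t x y) + eps / 2) / B) - Cabs2 (p x y)) in *.
      replace (C1 - RtoC (1 - (Re (t x y) + eps / 2) / B) - RtoC (Cabs2 (p x y)))%C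
        with (RtoC d) in Hpeps by (unfold d; C_by_parts).
      rewrite Cabs_RtoC in Hpeps.
      (* The error splits into [B d], smaller than [eps/2] in absolute value, and the added constant
         [eps/2]. *)
      replace (t x y - mkC (B * Cabs2 (p x y)) 0)%C with (RtoC (B * d - eps / 2)).
      2:{ apply C_ext; simpl; rewrite ?Him; unfold d; field; lra. }
      rewrite Cabs_RtoC. apply Rabs_def2 in Hpeps. destruct Hpeps as [H1 H2].
      apply (Rmult_lt_compat_l B) in H1, H2; try lra.
      replace (B * (eps / 2 / B)) with (eps / 2) in H1 by (field; lra).
      replace (B * - (eps / 2 / B)) with (- (eps / 2)) in H2 by (field; lra).
      apply Rabs_def1; lra.
Qed.

Theorem theorem4 (alpha : R)
  (Halpha : rational alpha \/ (~ rational alpha /\ LR_gt2 alpha)) :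
  forall beta : R, 0 < beta -> PropertyA (F2 alpha beta).
Proof.
  intros beta Hbeta t. split; [apply U2_T2plus | apply T2plus_U2, Hbeta].
Qed.
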